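(* Let $(M^{2n},\omega)$ be a compact connected toric symplectic orbifold with momentum map $\nu\colon M\to \Delta\subset \mathbb{R}^{n*}$, where the image $\Delta=\nu(M)$ is the (rational) Delzant polytope given by $$\Delta=\{x\in\mathbb{R}^{n*} : \ell_j(x)\geq 0,\quad j=1,\ldots, d\},\qquad \ell_j(x)=\langle u_j,x\rangle-\lambda_j,$$ with $u_j\in\mathbb{Z}^n$ and $\lambda_j\in\mathbb{R}$. Equip $M$ with the Guillemin metric $g$. Then the reduced metric on the interior $\Delta_0$ of $\Delta$ is $$g_{\rm red}= \frac12\sum_{j=1}^d \frac{(d\ell_j)^2}{\ell_j},$$ and a dual potential $G$ and a Kähler potential $F$ are given by $$G=\frac 12 \sum_{j=1}^d \ell_j(x)\log \ell_j(x),\qquad F=\frac 12 \sum_{j=1}^d \bigl( \lambda_j \log\ell_j(x) +\ell_j(x)\bigr).$$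
   Context: **Toric symplectic orbifolds.** $\mathbb{R}^n$ is the Lie algebra of the torus $T^n=\mathbb{R}^n/2\pi\mathbb{Z}^n$, and $\mathbb{R}^{n*}$ is its dual. A toric symplectic manifold (orbifold) is a $2n$-dimensional symplectic manifold (orbifold) $(M,\omega)$ with an effective hamiltonian $T^n$-action. A momentum map is a $T^n$-invariant map $\nu\colon M\to\mathbb{R}^{n*}$ with $\iota_{X_\xi}\omega=-\langle d\nu,\xi\rangle$ for all $\xi\in\mathbb{R}^n$, where $X_\xi$ is the vector field on $M$ generated by $\xi$. **Rational Delzant polytope.** This is a compact convex polytope $\Delta\subset\mathbb{R}^{n*}$ defined by $\langle x,u_j\rangle\ge\lambda_j$, $j=1,\dots,d$, where $d>n$ is the number of codimension-one faces, the $j$-th inequality corresponds to the $j$-th face, $u_j\in\mathbb{Z}^n$, $\lambda_j\in\mathbb{R}$, and for each vertex the $u_j$ corresponding to the faces meeting that vertex form a basis of $\mathbb{R}^n$. It is integral (a Delzant polytope) if these $u_j$ always form a $\mathbb{Z}$-basis of $\mathbb{Z}^n$. The vectors $u_j$ are part of the data. Compact connected toric symplectic orbifolds (manifolds) correspond one-to-one, up to equivariant symplectomorphism, to rational (integral) Delzant polytopes, the polytope being the image of the momentum map. The orbifold associated to $\Delta$ is the following one. **Delzant construction.** Let $T^d=\mathbb{R}^d/2\pi\mathbb{Z}^d$ act on $\mathbb{R}^{2d}\cong\mathbb{C}^d$ by $[a_1,\dots,a_d]\cdot(z_1,\dots,z_d)=(e^{ia_1}z_1,\dots,e^{ia_d}z_d)$.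 With $z_j=r_je^{i\theta_j}$, the symplectic form is $\sum_j r_j\,dr_j\wedge d\theta_j=\frac i2\sum_j dz_j\wedge d\bar z_j$ and the momentum map is $\mu(z)=\frac12(r_1^2,\dots,r_d^2)\in\mathbb{R}^{d*}$. Let $u\colon\mathbb{R}^d\to\mathbb{R}^n$ be the linear map sending the $j$-th standard basis vector to $u_j$. Write $u$ also for the induced homomorphism $T^d\to T^n$, and let $N=\ker(u\colon T^d\to T^n)$, with Lie algebra $\mathfrak n=\ker (u\colon\mathbb{R}^d\to\mathbb{R}^n)$ and inclusion $i\colon\mathfrak n\to\mathbb{R}^d$. Let $\mu_N=i^*\circ\mu$ and $c=i^*(-\lambda)$ with $\lambda=(\lambda_1,\dots,\lambda_d)\in\mathbb{R}^{d*}$. Then $M=\mu_N^{-1}(c)/N$ is the symplectic quotient, with quotient map $q$ and the residual action of $T^n=T^d/N$. Its momentum map $\nu$ is determined by $\ell(\nu(q(z)))=\mu(z)$ for $z\in\mu_N^{-1}(c)$, where $\ell=(\ell_1,\dots,\ell_d)\colon\mathbb{R}^{n*}\to\mathbb{R}^{d*}$. **Guillemin metric.** This is the Kähler metric $g$ on $M$ (with Kähler form $\omega$) induced on the Kähler quotient by the flat metric $\sum_j dz_j\,d\bar z_j=\sum_j (dr_j^2+r_j^2d\theta_j^2)$ of $\mathbb{C}^d$. That is, $q\colon\mu_N^{-1}(c)\to M$ is a riemannian submersion, where $\mu_N^{-1}(c)$ carries the restricted flat metric. **Reduced metric and potentials.** Let $M_0=\nu^{-1}(\Delta_0)$, on which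 $\nu\colon M_0\to\Delta_0$ is a principal $T^n$-bundle. The reduced metric $g_{\rm red}$ is the unique riemannian metric on $\Delta_0$ such that $\nu\colon M_0\to\Delta_0$ is a riemannian submersion. A dual potential is a function $G$ on $\Delta_0$ whose hessian in affine coordinates $x=(x_1,\dots,x_n)$ on $\mathbb{R}^{n*}$ gives the reduced metric: $g_{\rm red}=\sum_{r,s}\frac{\partial^2G}{\partial x_r\partial x_s}dx_r\,dx_s$. A Kähler potential is a function, here of the form $F\circ\nu$ on $M_0$ and denoted simply $F$, such that $\omega=dd^c(F\circ \nu)$ on $M_0$. Here $d^c=J\circ d$ with $J\alpha=-\alpha\circ J$ on $1$-forms, and $J$ is the complex structure of the Kähler metric, with $g=\omega(\cdot,J\cdot)$. *)

(* Defs.v *)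
From HB Require Import structures.
From mathcomp Require Import all_boot all_order all_algebra.
From mathcomp Require Import all_classical all_reals all_analysis.
Set Implicit Arguments.
Unset Strict Implicit.
Unset Printing Implicit Defensive.
Import Order.TTheory GRing.Theory Num.Theory.
Import numFieldNormedType.Exports.
Local Open Scope classical_set_scope.
Local Open Scope ring_scope.

(* Conventions.  Vectors of R^n are columns 'cV[R]_n,
   covectors of R^{n*} are rows 'rV[R]_n, and <x, xi> is the entry of x *m xi.
   C^d = R^{2d} is 'M[R]_(2, d): column j is z_j, with real part z 0 j and
   imaginary part z 1 j.  The vectors u_j are the columns of an integer
   n x d matrix. *)

Section Calculus.
Context {R : realType}.

(* C^k on an open set A of a finite-dimensional space: all iterated directional
   derivatives of order <= k exist on A, those of order k being continuous. *)
Fixpoint Ck_on (V W : normedModType R) (k : nat) (A : set V) (f : V -> W) :=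
  if k is k'.+1 then
    forall v : V, (forall x, A x -> derivable f x v) /\ Ck_on k' A ('D_v f)
  else forall x, A x -> {for x, continuous f}.

Definition smooth_on (V W : normedModType R) (A : set V) (f : V -> W) :=
  forall k, Ck_on k A f.

Definition curve_in (V : normedModType R) (A : set V) (gamma : R -> V) :=
  (\forall t \near (0 : R), A (gamma t)) /\ derivable gamma 0 1.

(* Tangent vectors to a subset are velocities of curves lying in it. *)
Definition tangent (V : normedModType R) (A : set V) (z : V) : set V :=
  [set v | exists gamma : R -> V,
    [/\ curve_in A gamma, gamma 0 = z & derive1 gamma 0 = v]].

Definition riemannian_metric_on n (A : set 'rV[R]_n)
    (h : 'rV[R]_n -> 'rV[R]_n -> 'rV[R]_n -> R) :=
  (forall x, A x ->
    [/\ forall a b, h x a b = h x b a,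
        forall (t : R) a b c, h x (t *: a + b) c = t * h x a c + h x b c &
        forall a, a != 0 -> 0 < h x a a]) /\
  (forall a b, smooth_on A (fun x => h x a b)).

End Calculus.

Section Polytope.
Context {R : realType} {n : nat}.

Definition affinely_independent k (P : 'I_k.+1 -> 'rV[R]_n) :=
  row_free (\matrix_(i < k) (P (lift ord0 i) - P ord0)).

Definition has_dim (A : set 'rV[R]_n) (k : nat) :=
  (exists P : 'I_k.+1 -> 'rV[R]_n,
     (forall i, A (P i)) /\ affinely_independent P) /\
  (forall P : 'I_k.+2 -> 'rV[R]_n,
     (forall i, A (P i)) -> ~~ affinely_independent P).

Definition is_face (D F : set 'rV[R]_n) :=
  exists (a : 'cV[R]_n) (b : R),
    (forall x, D x -> b <= (x *m a) 0 0) /\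
    F = [set x | D x /\ (x *m a) 0 0 = b].

Definition is_facet (D F : set 'rV[R]_n) :=
  is_face D F /\ exists2 k : nat, n = k.+1 & has_dim F k.

Definition is_vertex (D : set 'rV[R]_n) (x : 'rV[R]_n) := is_face D [set x].

End Polytope.

Notation orbit_class R d := (set 'M[R]_(2, d)).
Notation tangent_class R d := (set ('M[R]_(2, d) * 'M[R]_(2, d))).

Section Delzant.
Context {R : realType} {n d : nat}.
Variables (u : 'M[int]_(n, d)) (lambda : 'rV[R]_d).

(* Also the matrix of the linear map u : R^d -> R^n. *)
Definition umx : 'M[R]_(n, d) := map_mx intr u.

Definition ell (x : 'rV[R]_n) : 'rV[R]_d := x *m umx - lambda.

Definition Delta : set 'rV[R]_n := [set x | forall j, 0 <= ell x 0 j].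

Definition Delta0 : set 'rV[R]_n := Delta°.

Definition facet (j : 'I_d) : set 'rV[R]_n :=
  [set x | Delta x /\ ell x 0 j = 0].

Definition rational_Delzant :=
  [/\ compact Delta, (n < d)%N,
      [/\ forall j, is_facet Delta (facet j),
          injective facet &
          forall F, is_facet Delta F -> exists j, F = facet j] &
      forall x, is_vertex Delta x ->
        basis_of (@fullv R 'cV[R]_n)
          [seq col j umx | j in [pred j : 'I_d | ell x 0 j == 0]]].

(* The torus T^d is represented by its Lie algebra R^d, of which it is the
   quotient by 2 pi Z^d. *)
Definition torus_act (a : 'cV[R]_d) (z : 'M[R]_(2, d)) : 'M[R]_(2, d) :=
  \matrix_(k, j)
    if k == 0 then cos (a j 0) * z 0 j - sin (a j 0) * z 1 j
    else sin (a j 0) * z 0 j + cos (a j 0) * z 1 j.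

(* The preimage in R^d of N = ker (u : T^d -> T^n). *)
Definition N : set 'cV[R]_d :=
  [set a | exists m : 'cV[int]_n, umx *m a = (2 * pi) *: map_mx intr m].

Definition lieN : set 'cV[R]_d := [set xi | umx *m xi = 0].

Definition generated_field (xi : 'cV[R]_d) (z : 'M[R]_(2, d)) : 'M[R]_(2, d) :=
  derive1 (fun t : R => torus_act (t *: xi) z) 0.

Definition mu (z : 'M[R]_(2, d)) : 'rV[R]_d :=
  \row_j (2^-1 * (z 0 j ^+ 2 + z 1 j ^+ 2)).

(* mu_N^{-1}(c): elements of the dual of ker u are compared on ker u. *)
Definition level : set 'M[R]_(2, d) :=
  [set z | forall xi, lieN xi -> mu z *m xi = - lambda *m xi].

(* g(v, w) of the flat metric sum_j dz_j d\bar z_j, and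
   sum_j dx_j /\ dy_j = sum_j r_j dr_j /\ dtheta_j. *)
Definition flat_metric (v w : 'M[R]_(2, d)) : R :=
  \sum_j (v 0 j * w 0 j + v 1 j * w 1 j).
Definition flat_form (v w : 'M[R]_(2, d)) : R :=
  \sum_j (v 0 j * w 1 j - v 1 j * w 0 j).

(* A point of M = mu_N^{-1}(c) / N is an N-orbit, and q is the quotient map. *)
Definition q (z : 'M[R]_(2, d)) : set 'M[R]_(2, d) :=
  [set z' | exists2 a, N a & z' = torus_act a z].
Definition M : set (orbit_class R d) := [set q z | z in level].

(* The differential of q at z.  Over M_0, where N acts freely, TM is the
   quotient of T(mu_N^{-1}(c)) by the lifted action of N and by the vectors
   tangent to the orbits; a tangent vector of M is thus a class of pairs
   (z, v).  As torus_act a is linear, it is its own differential. *)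
Definition dq (z v : 'M[R]_(2, d)) : tangent_class R d :=
  [set zv | exists a xi, [/\ N a, lieN xi &
     zv = (torus_act a z, torus_act a (v + generated_field xi z))]].

Definition momentum_map (nu : orbit_class R d -> 'rV[R]_n) :=
  forall z, level z -> ell (nu (q z)) = mu z.

Section Quotient.
Variable nu : orbit_class R d -> 'rV[R]_n.

Definition M0 : set (orbit_class R d) := [set p | M p /\ Delta0 (nu p)].

Definition level0 : set 'M[R]_(2, d) := [set z | level z /\ M0 (q z)].

Definition TM (p : orbit_class R d) : set (tangent_class R d) :=
  [set X | exists z v,
    [/\ level0 z, p = q z, tangent level z v & X = dq z v]].

(* df(X) for f on M_0: the derivative of f along a curve q o gamma in M with
   velocity X. *)
Definition dM (W : normedModType R) (f : orbit_class R d -> W)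
    (X : tangent_class R d) : W :=
  xget 0 [set w | exists gamma : R -> 'M[R]_(2, d),
    [/\ curve_in level gamma, X = dq (gamma 0) (derive1 gamma 0) &
        is_derive (0 : R) 1 (f \o q \o gamma) w]].

Definition horizontal (z : 'M[R]_(2, d)) : set 'M[R]_(2, d) :=
  [set v | tangent level z v /\
           forall xi, lieN xi -> flat_metric v (generated_field xi z) = 0].

(* The symplectic form of the quotient: q^* omega is the restriction of the
   flat form. *)
Definition reduced_symplectic_form
    (omega : tangent_class R d -> tangent_class R d -> R) :=
  forall z v w, level0 z -> tangent level z v -> tangent level z w ->
    omega (dq z v) (dq z w) = flat_form v w.

(* q is a riemannian submersion. *)
Definition Guillemin_metric (g : tangent_class R d -> tangent_class R d -> R) :=
  forall z v w, level0 z -> horizontal z v -> horizontal z w ->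
    g (dq z v) (dq z w) = flat_metric v w.

(* g = omega (., J .) *)
Definition complex_structure
    (omega g : tangent_class R d -> tangent_class R d -> R)
    (J : tangent_class R d -> tangent_class R d) :=
  forall p, M0 p -> forall Y, TM p Y ->
    TM p (J Y) /\ forall X, TM p X -> g X Y = omega X (J Y).

(* The orthogonal complement of ker (d nu) in T_p M. *)
Definition nu_horizontal (g : tangent_class R d -> tangent_class R d -> R)
    (p : orbit_class R d) : set (tangent_class R d) :=
  [set X | TM p X /\ forall Y, TM p Y -> dM nu Y = 0 -> g X Y = 0].

(* h is a riemannian metric on Delta_0 such that nu : M_0 -> Delta_0 is a
   riemannian submersion. *)
Definition reduced_metric (g : tangent_class R d -> tangent_class R d -> R)
    (h : 'rV[R]_n -> 'rV[R]_n -> 'rV[R]_n -> R) :=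
  riemannian_metric_on Delta0 h /\
  forall p, M0 p ->
    (forall a, exists2 X, TM p X & dM nu X = a) /\
    (forall X Y, nu_horizontal g p X -> nu_horizontal g p Y ->
       h (nu p) (dM nu X) (dM nu Y) = g X Y).

Definition hessian (G : 'rV[R]_n -> R) (x a b : 'rV[R]_n) : R :=
  \sum_r \sum_s 'D_(delta_mx 0 r) ('D_(delta_mx 0 s) G) x * a 0 r * b 0 s.

Definition dual_potential (g : tangent_class R d -> tangent_class R d -> R)
    (G : 'rV[R]_n -> R) :=
  smooth_on Delta0 G /\ reduced_metric g (hessian G).

(* beta = d alpha on M_0.  The smooth maps to M_0 are locally of the form q o s
   with s smooth in mu_N^{-1}(c), and beta = d alpha is tested on their
   pull-backs to R^2, with
   d(a_1 dt_1 + a_2 dt_2) = (D_1 a_2 - D_2 a_1) dt_1 /\ dt_2. *)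
Definition exterior_derivative (alpha : tangent_class R d -> R)
    (beta : tangent_class R d -> tangent_class R d -> R) :=
  forall s : R * R -> 'M[R]_(2, d),
    smooth_on setT s -> (forall t, level0 (s t)) ->
    let e1 : R * R := (1, 0) in
    let e2 : R * R := (0, 1) in
    let X1 t := dq (s t) ('D_e1 s t) in
    let X2 t := dq (s t) ('D_e2 s t) in
    forall t,
      [/\ derivable (alpha \o X2) t e1, derivable (alpha \o X1) t e2 &
          beta (X1 t) (X2 t) = 'D_e1 (alpha \o X2) t - 'D_e2 (alpha \o X1) t].

(* d^c f = J (df) = - df o J *)
Definition dc (J : tangent_class R d -> tangent_class R d)
    (f : orbit_class R d -> R) (X : tangent_class R d) : R := - dM f (J X).

Definition Kaehler_potential (omega : tangent_class R d -> tangent_class R d -> R)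
    (J : tangent_class R d -> tangent_class R d) (F : 'rV[R]_n -> R) :=
  smooth_on Delta0 F /\ exterior_derivative (dc J (F \o nu)) omega.

End Quotient.

End Delzant.

(* Main.v *)
Require Import Defs.
From HB Require Import structures.
From mathcomp Require Import all_boot all_order all_algebra.
From mathcomp Require Import all_classical all_reals all_analysis.
From mathcomp Require Import ring lra.
Set Implicit Arguments.
Unset Strict Implicit.
Unset Printing Implicit Defensive.
Import Order.TTheory GRing.Theory Num.Theory.
Import numFieldNormedType.Exports.
Local Open Scope classical_set_scope.
Local Open Scope ring_scope.

(* On M_0 write z_j = r_j e^{i theta_j}.  A tangent vector of the level set is
   given by r_j dr_j = <a, u_j> with a = d(nu), and by arbitrary angular
   velocities; it is orthogonal to the N-orbits iff r_j^2 dtheta_j = <c, u_j>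
   for some covector c.  Hence tangent vectors of M_0 are pairs (a, c).  With
     B(a, b) = sum_j <a, u_j> <b, u_j> / (2 l_j),  2 l_j = r_j^2,
   one finds g = B(a, a') + B(c, c') and omega = B(a, c') - B(c, a'), so that
   J (a, c) = (-c, a) and g_red = B, which is the hessian of G.  As dF = B(x, .)
   at x, the form d^c F is B(x, c) = sum_j (r_j^2 / 2 + lambda_j) dtheta_j,
   whose exterior derivative is sum_j r_j dr_j /\ dtheta_j = omega. *)

(** * Directional derivatives *)

(** The data [omega], [g] and [J] are arbitrary functions on classes [dq z v], known only through
    equations on representatives, so each tangent vector must first be brought to a normal form over
    a given [z]. The covector c solves B(., c) = sum_j <., u_j> dtheta_j, the normal equation of a
    weighted least-squares problem; it is solvable because B is positive definite over Delta_0,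
    where l_j > 0 and where compactness of the polytope makes the u_j span. The component -c of J
    (a, c) is what d^c of a function of nu sees. The same equation then eliminates c from B(x, c),
    leaving an expression in z and dtheta_j, so that d can be computed in C^d; there lambda_j drops
    out because dtheta_j is closed. As [smooth_on] speaks of directional derivatives, the symmetry
    of mixed second derivatives comes from mean values, and smoothness on Delta_0 from a class of
    sums of functions phi_j (l_j) that is stable under differentiation. *)

Section DirectionalDerivatives.
Context {R : realType}.

(** Restriction to a line reduces directional derivatives to calculus in one real variable, where
    the chain rule and the mean value theorem apply. *)
Lemma is_derive_lineP (V W : normedModType R) (f : V -> W) x v df :
  is_derive x v f df <-> is_derive (0 : R) 1 (fun h : R => f (h *: v + x)) df.
Proof.
have E : 'D_v f x = 'D_1 (fun h : R => f (h *: v + x)) 0.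
  rewrite /derive; set g := fun h => h^-1 *: _; set k := fun h => h^-1 *: _.
  suff -> : g = k by [].
  by apply/funext => h; rewrite /g /k/= addr0 scale0r add0r -[h%:A]/(h * 1) mulr1.
split=> -[dfx <-]; apply: DeriveDef; rewrite ?E//.
  exact: (derivable1P f x v).1 dfx.
exact: (derivable1P f x v).2 dfx.
Qed.

Lemma is_derive_comp_scalar (V : normedModType R) (f : R -> R) (g : V -> R) x v a b :
  is_derive (g x) 1 f a -> is_derive x v g b ->
  is_derive x v (fun y => f (g y)) (a * b).
Proof.
move=> fa /is_derive_lineP gb; apply/is_derive_lineP.
apply: (@is_derive1_comp R f (fun h => g (h *: v + x)) 0 a b) => //.
by rewrite scale0r add0r.
Qed.

Lemma is_derive_sum_fun (V W : normedModType R) n (h : 'I_n -> V -> W) x v dh :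
  (forall i, is_derive x v (h i) (dh i)) ->
  is_derive x v (fun y => \sum_(i < n) h i y) (\sum_(i < n) dh i).
Proof.
move=> H; have := is_derive_sum H; congr is_derive.
by apply/funext => y; rewrite fct_sumE.
Qed.

Lemma is_derive_mxP (V : normedModType R) m n (M : V -> 'M[R]_(m, n)) t v dM :
  is_derive t v M dM <-> forall i j, is_derive t v (fun x => M x i j) (dM i j).
Proof.
split=> [[dMt <-] i j|H].
- split; first by move/derivable_mxP: dMt.
  by rewrite derive_mx// mxE.
- have dMt : derivable M t v by apply/derivable_mxP => i j; case: (H i j).
  split=> //; rewrite derive_mx//; apply/matrixP => i j; rewrite mxE.
  by case: (H i j).
Qed.

Lemma is_derive_prod (V : normedModType R) (f g : V -> R) x v a b :
  is_derive x v f a -> is_derive x v g b ->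
  is_derive x v (fun y => f y * g y) (f x * b + g x * a).
Proof. exact: is_deriveM. Qed.

Lemma is_derive_inv (V : normedModType R) (f : V -> R) x v a :
  f x != 0 -> is_derive x v f a ->
  is_derive x v (fun y => (f y)^-1) (- (f x) ^- 2 * a).
Proof.
by move=> f0 [df <-]; split; [exact: derivableV | rewrite deriveV].
Qed.

(** Differentiability in the Fréchet sense is assumed: directional derivatives alone do not control
    [f] along a curve that is not a line. *)
Lemma derive_curve_comp (V W : normedModType R) (f : V -> W) (c : R -> V) (t : R) a :
  differentiable f (c t) -> is_derive t 1 c a ->
  is_derive t 1 (f \o c) ('D_a f (c t)).
Proof.
move=> df [/derivable1_diffP dc ca]; apply: DeriveDef.
  exact/derivable1_diffP/differentiable_comp.
rewrite -ca (deriveE _ df) (deriveE _ dc) (deriveE _ (differentiable_comp dc df)).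
by rewrite diff_comp.
Qed.

(** * Symmetry of mixed second derivatives *)

Section Schwarz.
Context {V : normedModType R}.

(** Two mean values over the parallelogram with sides h e1 and h e2: one along e1, for the
    difference of [f] between two opposite sides, then one along e2, for the derivative of [f] in
    direction e1. *)
Lemma mixed_difference (f : V -> R) (t e1 e2 : V) (h : R) : 0 < h ->
  (forall x, derivable f x e1) -> (forall x, derivable ('D_e1 f) x e2) ->
  exists c1 c2, [/\ 0 < c1 < h, 0 < c2 < h &
    f (h *: e1 + (h *: e2 + t)) - f (h *: e1 + t) - f (h *: e2 + t) + f t =
    'D_e2 ('D_e1 f) (c2 *: e2 + (c1 *: e1 + t)) * h * h].
Proof.
move=> h0 d1 d2.
have shiftD (k : V -> R) e x s : (forall y, derivable k y e) ->
    is_derive (s : R) 1 (fun r : R => k (r *: e + x)) ('D_e k (s *: e + x)).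
  move=> dk; apply/is_derive_lineP.
  have /derivableP/is_derive_lineP := dk (s *: e + x); congr is_derive.
  by apply/funext => r; rewrite -[r%:A]/(r * 1) mulr1 scalerDl addrA.
have mvt (k k' : R -> R) : (forall s : R, is_derive s 1 k (k' s)) ->
    exists2 c, 0 < c < h & k h - k 0 = k' c * h.
  move=> dk.
  have dk1 (s : R) : s \in `]0, h[%R -> is_derive s 1 k (k' s) by [].
  have kc : {within `[0, h], continuous k}.
    apply: continuous_subspaceT => s; apply/differentiable_continuous.
    by apply/derivable1_diffP; case: (dk s).
  have [c] := MVT h0 dk1 kc.
  by rewrite in_itv/= subr0 => ? ?; exists c.
have [s|c1 c1h E1] := mvt (fun s => f (s *: e1 + (h *: e2 + t)) - f (s *: e1 + t))
   (fun s => 'D_e1 f (s *: e1 + (h *: e2 + t)) - 'D_e1 f (s *: e1 + t)).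
  by apply: is_deriveB; exact: shiftD.
have [s|c2 c2h E2] := mvt (fun s => 'D_e1 f (s *: e2 + (c1 *: e1 + t)))
   (fun s => 'D_e2 ('D_e1 f) (s *: e2 + (c1 *: e1 + t))).
  exact: shiftD.
exists c1, c2; split => //; rewrite -E2.
move: E1; rewrite !scale0r !add0r => E1.
by rewrite [h *: e2 + (c1 *: e1 + t)]addrCA -E1 opprB [RHS]addrA [RHS]addrAC.
Qed.

(** The second difference of [f] is symmetric in e1 and e2, so the two mixed derivatives agree at a
    pair of points arbitrarily close to [t]; continuity carries the equality to [t]. *)
Lemma derive_commute (f : V -> R) (t e1 e2 : V) :
  (forall x, derivable f x e1) -> (forall x, derivable f x e2) ->
  (forall x, derivable ('D_e1 f) x e2) -> (forall x, derivable ('D_e2 f) x e1) ->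
  {for t, continuous ('D_e2 ('D_e1 f))} ->
  {for t, continuous ('D_e1 ('D_e2 f))} ->
  'D_e2 ('D_e1 f) t = 'D_e1 ('D_e2 f) t.
Proof.
have close_split (e p1 p2 p3 : R) :
    `|p1 - p3| < e / 2 -> `|p2 - p3| < e / 2 -> `|p1 - p2| <= e.
  move=> h1 h2; rewrite -(subrKA p3) (splitr e) (le_trans (ler_normD _ _))//.
  by rewrite lerD ?(ltW h1)// distrC ltW.
move=> d1 d2 d12 d21 c12 c21; apply/eqP; rewrite -subr_eq0 -normr_eq0.
rewrite eq_le normr_ge0 andbT; apply/ler_addgt0Pl => e e0; rewrite addr0.
have e20 : 0 < e / 2 by rewrite divr_gt0.
move/cvgrPdist_lt : c12 => /(_ _ e20) /nbhs_normP[r1 /= r10 H1].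
move/cvgrPdist_lt : c21 => /(_ _ e20) /nbhs_normP[r2 /= r20 H2].
have [h h0 small] : exists2 h, 0 < h & forall x y, 0 < x < h -> 0 < y < h ->
    `|x *: e1 + y *: e2| < Num.min r1 r2.
  (* The summand 1 keeps the denominator positive even when e1 and e2 both vanish. *)
  have K0 : 0 < `|e1| + `|e2| + 1 by rewrite ltr_wpDl// addr_ge0.
  exists (Num.min r1 r2 / (`|e1| + `|e2| + 1)).
    by rewrite divr_gt0// lt_min r10 r20.
  move=> x y /andP[x0 xh] /andP[y0 yh]; rewrite (le_lt_trans (ler_normD _ _))//.
  rewrite !normrZ !gtr0_norm//.
  have xr : x * (`|e1| + `|e2| + 1) < Num.min r1 r2 by rewrite -ltr_pdivlMr.
  have yr : y * (`|e1| + `|e2| + 1) < Num.min r1 r2 by rewrite -ltr_pdivlMr.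
  have := normr_ge0 e1; have := normr_ge0 e2.
  by case: (lerP x y) => xy e20' e10'; nra.
have [a1 [a2 [a1h a2h E1]]] := mixed_difference t h0 d1 d12.
have [b2 [b1 [b2h b1h E2]]] := mixed_difference t h0 d2 d21.
have E : 'D_e2 ('D_e1 f) (a2 *: e2 + (a1 *: e1 + t)) =
         'D_e1 ('D_e2 f) (b1 *: e1 + (b2 *: e2 + t)).
  apply: (mulIf (lt0r_neq0 h0)); apply: (mulIf (lt0r_neq0 h0)).
  apply: (etrans (esym E1)); apply: etrans E2.
  by rewrite [h *: e2 + (h *: e1 + t)]addrCA [X in X + _ = _]addrAC.
have /lt_le_trans sa := small _ _ a1h a2h; have /lt_le_trans sb := small _ _ b1h b2h.
have {}H1 := H1 (a2 *: e2 + (a1 *: e1 + t)).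
have {}H2 := H2 (b1 *: e1 + (b2 *: e2 + t)).
rewrite -E in H2.
have A1 : `|'D_e2 ('D_e1 f) t - 'D_e2 ('D_e1 f) (a2 *: e2 + (a1 *: e1 + t))| < e / 2.
  apply: H1; rewrite /ball_/=.
  have -> : t - (a2 *: e2 + (a1 *: e1 + t)) = - (a1 *: e1 + a2 *: e2).
    by rewrite addrA opprD addrCA subrr addr0 addrC.
  by rewrite normrN; apply: sa; rewrite ge_min lexx.
have A2 : `|'D_e1 ('D_e2 f) t - 'D_e2 ('D_e1 f) (a2 *: e2 + (a1 *: e1 + t))| < e / 2.
  apply: H2; rewrite /ball_/=.
  have -> : t - (b1 *: e1 + (b2 *: e2 + t)) = - (b1 *: e1 + b2 *: e2).
    by rewrite addrA opprD addrCA subrr addr0.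
  by rewrite normrN; apply: sb; rewrite ge_min lexx orbT.
exact: close_split A1 A2.
Qed.

End Schwarz.

End DirectionalDerivatives.

Section SecondDerivatives.
Context {R : realType} {V : normedModType R}.

Lemma derivable_derive_coord m n (s : V -> 'M[R]_(m, n)) e i j :
  (forall x, derivable s x e) ->
  'D_e (fun x => s x i j) = (fun x => 'D_e s x i j).
Proof. by move=> ds; apply/funext => x; rewrite derive_mx// mxE. Qed.

Lemma smooth_derive_commute m n (s : V -> 'M[R]_(m, n)) e1 e2 t :
  smooth_on setT s -> 'D_e1 ('D_e2 s) t = 'D_e2 ('D_e1 s) t.
Proof.
move=> ss.
have ds e x : derivable s x e by have [+ _] := ss 1%N e; apply.
have dds e f x : derivable ('D_e s) x f.
  by have [_ /(_ f)[+ _]] := ss 2%N e; apply.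
have cds e f x : {for x, continuous ('D_f ('D_e s))}.
  by have [_ /(_ f)[_ +]] := ss 2%N e; apply.
apply/matrixP => i j.
have dsij e := derivable_derive_coord i j (ds e).
have ddsij e f := derivable_derive_coord i j (dds e f).
have d1 e x : derivable (fun x => s x i j) x e by move/derivable_mxP: (ds e x).
have d2 e f x : derivable ('D_e (fun x => s x i j)) x f.
  by rewrite dsij; move/derivable_mxP: (dds e f x).
have c2 e f : {for t, continuous ('D_f ('D_e (fun x => s x i j)))}.
  rewrite dsij ddsij.
  apply: (@continuous_comp _ _ _ ('D_f ('D_e s)) (fun M : 'M[R]_(m, n) => M i j)).
    exact: cds.
  exact: coord_continuous.
have E e f : 'D_f ('D_e (fun x => s x i j)) t = 'D_f ('D_e s) t i j.
  by rewrite dsij; exact: (congr1 (@^~ t) (ddsij e f)).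
apply: etrans (E e1 e2); apply: etrans (esym (E e2 e1)) _.
exact: (derive_commute (d1 e2) (d1 e1) (d2 e2 e1) (d2 e1 e2) (c2 e2 e1) (c2 e1 e2)).
Qed.

End SecondDerivatives.

(** * Smooth functions *)

Section Smooth.
Context {R : realType}.

(** [Ck_on] peels off one derivative at a time, so a class of continuous functions that is closed
    under directional derivatives contains only smooth ones. *)
Lemma smooth_on_coind (V W : normedModType R) (A : set V) (P : (V -> W) -> Prop) :
  (forall f, P f -> (forall x, A x -> {for x, continuous f}) /\
     forall v, (forall x, A x -> derivable f x v) /\ P ('D_v f)) ->
  forall f, P f -> smooth_on A f.
Proof.
move=> HP f Pf k; elim: k f Pf => [|k IH] f /HP[cf df] //= v.
by have [? /IH] := df v.
Qed.

(** Since [A] is open, equality on [A] holds near each of its points and therefore passes to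
    derivatives. *)
Lemma smooth_on_eq (V W : normedModType R) (A : set V) (f g : V -> W) :
  open A -> (forall x, A x -> f x = g x) -> smooth_on A g -> smooth_on A f.
Proof.
move=> oA fg sg k; have {sg} := sg k.
have near_fg T (f1 g1 : V -> T) : (forall x, A x -> f1 x = g1 x) ->
    forall x, A x -> \forall y \near x, g1 y = f1 y.
  move=> e x Ax; near do apply/esym/e.
  exact: open_nbhs_nbhs.
elim: k f g fg => [|k IH] f g fg /= sg.
  move=> x Ax; rewrite /prop_for /continuous_at fg//.
  have sgx : g @ x --> g x := sg x Ax.
  by apply: cvg_trans sgx; exact: (near_eq_cvg (near_fg _ _ _ fg x Ax)).
move=> v; have [dg sdg] := sg v; split=> [x Ax|].
  exact: (near_eq_derivable (near_fg _ _ _ fg x Ax) (dg x Ax)).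
apply: IH sdg => x Ax; apply: near_eq_derive.
by have := near_fg _ _ _ (fun x Ax => esym (fg x Ax)) x Ax.
Unshelve. all: by end_near. Qed.

(* Smoothness on the positive half-line only. *)
Definition scalar_smooth (phi : R -> R) := exists D : nat -> R -> R,
  D 0 = phi /\ forall k (t : R), 0 < t -> is_derive t 1 (D k) (D k.+1 t).

Lemma scalar_smooth_inv : scalar_smooth (fun t => t^-1).
Proof.
exists (fun k t => (-1) ^+ k * k`!%:R * (t^-1) ^+ k.+1); split.
  by apply/funext => t; rewrite fact0 !mul1r expr1.
move=> k t t0; have tn0 := lt0r_neq0 t0.
have dV : is_derive t 1 (@GRing.inv R) (- t ^- 2 * 1).
  by apply: is_derive_inv => //; exact: is_derive_id.
have := is_deriveZ ((-1) ^+ k * k`!%:R) (is_deriveX k.+1 dV).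
rewrite exprfctE => H; apply: (is_derive_eq H); rewrite /= -exprVn.
rewrite -[_ *: (_ *: _)]/(_ * (_ * _)) factS natrM.
rewrite expr2 [(-1) ^+ k.+1]exprS 2![t^-1 ^+ _.+1]exprS.
by move: (k.+1%:R : R) => n; ring.
Qed.

Lemma scalar_smooth_comb (phi psi : R -> R) (a b : R) :
  scalar_smooth phi -> scalar_smooth psi ->
  scalar_smooth (fun t => a * phi t + b * psi t).
Proof.
move=> [D [<- HD]] [E [<- HE]].
exists (fun k t => a * D k t + b * E k t); split => // k t t0.
by apply: is_deriveD; apply: is_deriveZ; [exact: HD | exact: HE].
Qed.

(** The tower of derivatives of [phi], shifted by one, serves for [psi]. In this way the inverse
    yields ln, and ln + 1 yields t ln t. *)
Lemma scalar_smooth_integral (phi psi : R -> R) :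
  (forall t : R, 0 < t -> is_derive t 1 psi (phi t)) ->
  scalar_smooth phi -> scalar_smooth psi.
Proof.
move=> dpsi [D [D0 HD]].
exists (fun k => if k is k'.+1 then D k' else psi); split => // -[|k] t t0.
  by rewrite D0; exact: dpsi.
exact: HD.
Qed.

Lemma scalar_smooth_cst (a : R) : scalar_smooth (fun=> a).
Proof.
exists (fun k _ => if k is _.+1 then 0 else a).
by split => // -[|k] t _; exact: is_derive_cst.
Qed.

(** Each [ell] has a derivative [dell v j] that is constant in x, so differentiating such a sum
    multiplies c_j by that constant and replaces phi_j by its derivative: the shape is preserved. *)
Lemma smooth_on_sum_scalar (V : normedModType R) d (A : set V)
    (ell : V -> 'I_d -> R) (dell : V -> 'I_d -> R) (phi : 'I_d -> R -> R) (c : 'I_d -> R)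
    (f : V -> R) : open A ->
  (forall x j, A x -> 0 < ell x j) ->
  (forall j, continuous (ell ^~ j)) ->
  (forall x v j, is_derive x v (ell ^~ j) (dell v j)) ->
  (forall j, scalar_smooth (phi j)) ->
  (forall x, A x -> f x = \sum_j c j * phi j (ell x j)) ->
  smooth_on A f.
Proof.
move=> oA ell0 cell dl sphi fE.
(* The coefficients and the scalar functions change at each differentiation and are therefore
   quantified inside the class. *)
pose P (f : V -> R) := exists (c : 'I_d -> R) (phi : 'I_d -> R -> R),
  (forall j, scalar_smooth (phi j)) /\
  forall x, A x -> f x = \sum_j c j * phi j (ell x j).
apply: (@smooth_on_coind _ _ A P); last by exists c, phi.
move=> {c phi sphi f fE} f [c [phi [sphi fE]]].
have nearA x : A x -> \forall y \near x, \sum_j c j * phi j (ell y j) = f y.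
  by move=> Ax; near do rewrite fE//; exact: open_nbhs_nbhs.
have [D HD] := choice sphi.
have dphi j k (t : R) : 0 < t -> is_derive t 1 (D j k) (D j k.+1 t).
  by case: (HD j) => _; exact.
have D0 j : phi j = D j 0 by case: (HD j) => ->.
have df x v : A x -> is_derive x v f (\sum_j c j * dell v j * D j 1%N (ell x j)).
  move=> Ax; apply: (near_eq_is_derive (nearA x Ax)).
  apply: is_derive_sum_fun => j; rewrite D0.
  have H := is_derive_comp_scalar (dphi j 0%N _ (ell0 x j Ax)) (dl x v j).
  apply: (is_derive_eq (is_deriveZ (c j) H)).
  by rewrite -mulrA [D _ _ _ * _]mulrC.
split=> [x Ax|v].
  have fxE := fE x Ax.
  rewrite /prop_for /continuous_at fxE.
  apply: cvg_trans; first exact: (near_eq_cvg (nearA x Ax)).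
  apply: cvg_big => [|j _]; first exact: add_continuous.
  apply: cvgM; first exact: cvg_cst.
  rewrite D0; apply: (cvg_comp (ell ^~ j) (D j 0%N) (cell j x)).
  apply: (@differentiable_continuous _ _ _ (ell x j) (D j 0%N)).
  by apply/derivable1_diffP; have [] := dphi j 0%N _ (ell0 x j Ax).
split=> [x Ax|]; first by case: (df x v Ax).
exists (fun j => c j * dell v j), (fun j => D j 1%N); split=> [j|x Ax].
  exists (fun k => D j k.+1); split => // k t; exact: dphi.
by case: (df x v Ax).
Unshelve. all: by end_near. Qed.

End Smooth.

(** * Polytope and torus action *)

Section PolytopeInterior.
Context {R : realType} {n d : nat}.
Variables (u : 'M[int]_(n, d)) (lambda : 'rV[R]_d).
Local Notation U := (umx (R := R) u).
Local Notation ell := (ell u lambda).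
Local Notation Delta := (Delta u lambda).
Local Notation Delta0 := (Delta0 u lambda).

Lemma ell_add (x v : 'rV[R]_n) (t : R) : ell (x + t *: v) = ell x + t *: (v *m U).
Proof. by rewrite /Defs.ell mulmxDl -scalemxAl addrAC. Qed.

Lemma near_line (A : set 'rV[R]_n) (x v : 'rV[R]_n) :
  nbhs x A -> \forall t \near (0 : R), A (x + t *: v).
Proof.
move=> Ax; have c : (x + t *: v) @[t --> (0 : R)] --> x + 0 *: v.
  by apply: cvgD; [exact: cvg_cst | apply: cvgZr_tmp; exact: cvg_id].
by apply: c; rewrite scale0r addr0.
Qed.

Hypothesis hDelta : rational_Delzant u lambda.

(* Otherwise l_j vanishes identically and the whole n-dimensional polytope lies
   in a facet. *)
Lemma ell_gt0 x j : Delta0 x -> 0 < ell x 0 j.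
Proof.
move=> Dx; have Dxx := nbhs_singleton Dx.
rewrite lt_neqAle Dxx andbT eq_sym; apply/eqP => lx0.
have uj0 (v : 'rV[R]_n) : (v *m U) 0 j = 0.
  have Dl := near_line v Dx; have Dr := near_line (- v) Dx.
  (* One small t serves both v and -v. As l_j vanishes at x and is nonnegative on both sides, its
     slope along v is zero. *)
  have [t [t0 /(_ j) Dt /(_ j) Dt']] :
      exists t : R, [/\ 0 < t, Delta (x + t *: v) & Delta (x + t *: - v)].
    move: Dl Dr => /nbhs_normP[e1 /= e10 h1] /nbhs_normP[e2 /= e20 h2].
    exists (Num.min e1 e2 / 2); have m0 : 0 < Num.min e1 e2 by rewrite lt_min e10.
    have m20 : 0 < Num.min e1 e2 / 2 by rewrite divr_gt0.
    have me : Num.min e1 e2 / 2 < Num.min e1 e2 by rewrite ltr_pdivrMr// ltr_pMr// ltr1n.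
    split => //; [apply: h1|apply: h2]; rewrite /= sub0r normrN gtr0_norm//;
      by rewrite (lt_le_trans me)// ge_min lexx ?orbT.
  have E s : ell (x + s *: v) 0 j = s * (v *m U) 0 j.
    by rewrite ell_add [LHS]mxE lx0 add0r mxE.
  move: Dt Dt'; rewrite scalerN -scaleNr !E mulNr oppr_ge0.
  rewrite pmulr_rge0// pmulr_rle0// => a b.
  by apply/eqP; rewrite eq_le a b.
have [_ _ [/(_ j) [_ [k nk [_ noP]]] _ _] _] := hDelta.
have facetE y : Delta y -> facet u lambda j y.
  move=> Dy; split => //; rewrite -(subrK x y) -[y - x]scale1r addrC ell_add.
  by rewrite [LHS]mxE lx0 add0r mxE uj0 mulr0.
have : \forall t \near (0 : R), forall i, Delta (x + t *: delta_mx (0 : 'I_1) (i : 'I_n)).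
  exact: filter_forall (fun i => near_line (delta_mx 0 i) Dx).
move=> /nbhs_normP[e /= e0 he].
have {}he i : Delta (x + (e / 2) *: delta_mx (0 : 'I_1) (i : 'I_n)).
  apply: he; rewrite /= sub0r normrN gtr0_norm ?divr_gt0//.
  by rewrite ltr_pdivrMr// ltr_pMr// ltr1n.
(* The n + 1 = k + 2 points x and x + (e/2) e_i are affinely independent and lie in the facet, whose
   dimension is only k. *)
pose P (i : 'I_k.+2) : 'rV[R]_n :=
  if unlift ord0 i is Some i' then x + (e / 2) *: delta_mx 0 (cast_ord (esym nk) i') else x.
have Pf i : facet u lambda j (P i).
  by apply: facetE; rewrite /P; case: unliftP.
suff : affinely_independent P by apply/negP/noP.
apply: inj_row_free => w wP0; apply/rowP => i; rewrite [RHS]mxE.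
move/rowP: wP0 => /(_ (cast_ord (esym nk) i)); rewrite !mxE (bigD1 i)//= big1 => [|l li].
  rewrite addr0 !mxE /P liftK unlift_none !mxE !eqxx/= [x _ _ + _]addrC addrK mulr1 => /eqP.
  by rewrite mulf_eq0 (gt_eqF (divr_gt0 e0 _))// orbF => /eqP.
rewrite !mxE /P liftK unlift_none !mxE/= [x _ _ + _]addrC addrK.
by rewrite (inj_eq (@cast_ord_inj _ _ _)) eq_sym (negPf li) mulr0 mulr0.
Qed.

(** A covector v that annihilates every u_j would put the whole line x + t v inside the compact
    polytope. *)
Lemma row_free_umx x : Delta x -> row_free U.
Proof.
move=> Dx; apply: inj_row_free => v vU; apply/eqP/negPn/negP => v0.
have [/compact_bounded[B [_ hB]] _ _ _] := hDelta.
have bd := hB (B + 1) (ltr_pwDr ltr01 (lexx B)).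
have DE t : Delta (x + t *: v).
  by move=> j; rewrite ell_add vU scaler0 addr0.
have nv : 0 < `|v| by rewrite normr_gt0.
(* Chosen so that x + t v has norm at least B + 2, while the points of the polytope have norm at
   most B + 1. *)
pose t := (B + 1 + `|x| + 1) / `|v|.
have := bd _ (DE t); apply/negP; rewrite -ltNge.
have : `|t *: v| <= `|x + t *: v| + `|x|.
  by rewrite -[X in `|X| <= _](addKr x) addrC (le_trans (ler_normB _ _))// addrC.
rewrite normrZ.
have : B + 1 + `|x| + 1 <= `|t| * `|v|.
  by rewrite -ler_pdivrMr// ler_norm.
move=> h1 h2; have := le_trans h1 h2; rewrite addrAC lerD2r => h3.
by rewrite (lt_le_trans _ h3)// ltrDl.
Qed.

End PolytopeInterior.

(** * Rotations of C^d, polar components and classes of tangent vectors *)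

Section TorusAction.
Context {R : realType} {n d : nat}.
Variable u : 'M[int]_(n, d).
Implicit Types (z v w : 'M[R]_(2, d)) (a b xi : 'cV[R]_d) (p r : 'rV[R]_d).
Local Notation N := (@N R n d u).
Local Notation lieN := (@lieN R n d u).

Lemma eq_mx2 z w : z 0 =1 w 0 -> z 1 =1 w 1 -> z = w.
Proof.
move=> h0 h1; apply/matrixP => k j.
have /orP[] : (k == 0) || (k == 1) by case: k => -[|[|]].
- by move/eqP->; exact: h0.
- by move/eqP->; exact: h1.
Qed.

Lemma torus_actE0 a z j :
  torus_act a z 0 j = cos (a j 0) * z 0 j - sin (a j 0) * z 1 j.
Proof. by rewrite mxE. Qed.

Lemma torus_actE1 a z j :
  torus_act a z 1 j = sin (a j 0) * z 0 j + cos (a j 0) * z 1 j.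
Proof. by rewrite mxE. Qed.

Definition torus_actE := (torus_actE0, torus_actE1).

Lemma torus_act_comp a b z : torus_act a (torus_act b z) = torus_act (a + b) z.
Proof.
by apply: eq_mx2 => j; rewrite !torus_actE [(a + b) j 0]mxE cosD sinD; ring.
Qed.

Lemma torus_act0 z : torus_act 0 z = z.
Proof.
by apply: eq_mx2 => j; rewrite !torus_actE mxE cos0 sin0; ring.
Qed.

Lemma torus_actD a v w : torus_act a (v + w) = torus_act a v + torus_act a w.
Proof.
by apply: eq_mx2 => j; rewrite [RHS]mxE !torus_actE ![(v + w) _ _]mxE; ring.
Qed.

(** Multiplication of z_j by i xi_j. *)
Let field_matrix xi z : 'M[R]_(2, d) :=
  \matrix_(k, j) if k == 0 then - (xi j 0 * z 1 j) else xi j 0 * z 0 j.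

(** The point is allowed to move: a constant [Z] gives the generated field, a radially moving [Z]
    gives the curves that realize arbitrary polar velocities. *)
Let is_derive_rotated xi (Z : R -> 'M[R]_(2, d)) w : is_derive (0 : R) 1 Z w ->
  is_derive (0 : R) 1 (fun t : R => torus_act (t *: xi) (Z t))
    (w + field_matrix xi (Z 0)).
Proof.
move=> /is_derive_mxP dZ.
have H j : is_derive (0 : R) 1 (fun t : R => t * xi j 0) (xi j 0).
  have := is_derive_prod (is_derive_id (0 : R) 1) (is_derive_cst (xi j 0) (0 : R) 1).
  by move/is_derive_eq; apply; rewrite mulr0 add0r mulr1.
have Hc j : is_derive (0 : R) 1 (fun t : R => cos (t * xi j 0)) 0.
  have := @is_derive_comp_scalar R R cos _ 0 1 _ _ (is_derive_cos _) (H j).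
  by move/is_derive_eq; apply; rewrite mul0r sin0 oppr0 mul0r.
have Hs j : is_derive (0 : R) 1 (fun t : R => sin (t * xi j 0)) (xi j 0).
  have := @is_derive_comp_scalar R R sin _ 0 1 _ _ (is_derive_sin _) (H j).
  by move/is_derive_eq; apply; rewrite mul0r cos0 mul1r.
apply/is_derive_mxP => k j; rewrite [(w + _) k j]mxE [field_matrix _ _ k j]mxE.
have -> : (fun t : R => torus_act (t *: xi) (Z t) k j) = if k == 0
    then (fun t => cos (t * xi j 0) * Z t 0 j - sin (t * xi j 0) * Z t 1 j)
    else (fun t => sin (t * xi j 0) * Z t 0 j + cos (t * xi j 0) * Z t 1 j).
  by apply/funext => t; rewrite mxE [(t *: xi) j 0]mxE; case: (k == 0).
have [->|k1] := eqVneq k 0.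
- have := is_deriveB (is_derive_prod (Hc j) (dZ 0 j)) (is_derive_prod (Hs j) (dZ 1 j)).
  by move/is_derive_eq; apply; rewrite mul0r cos0 sin0; ring.
- have := is_deriveD (is_derive_prod (Hs j) (dZ 0 j)) (is_derive_prod (Hc j) (dZ 1 j)).
  have -> : k = 1 by case: k k1 => -[|[|]]// ? _; exact: val_inj.
  by move/is_derive_eq; apply; rewrite mul0r cos0 sin0; ring.
Qed.

Lemma generated_fieldE xi z : generated_field xi z =
  \matrix_(k, j) if k == 0 then - (xi j 0 * z 1 j) else xi j 0 * z 0 j.
Proof.
rewrite /generated_field derive1E.
have [_ ->] := is_derive_rotated xi (is_derive_cst z (0 : R) 1).
by rewrite add0r.
Qed.

Lemma is_derive_torus_act xi (Z : R -> 'M[R]_(2, d)) w : is_derive (0 : R) 1 Z w ->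
  is_derive (0 : R) 1 (fun t : R => torus_act (t *: xi) (Z t))
    (w + generated_field xi (Z 0)).
Proof. by rewrite generated_fieldE; exact: is_derive_rotated. Qed.

Lemma generated_fieldE0 xi z j : generated_field xi z 0 j = - (xi j 0 * z 1 j).
Proof. by rewrite generated_fieldE mxE. Qed.

Lemma generated_fieldE1 xi z j : generated_field xi z 1 j = xi j 0 * z 0 j.
Proof. by rewrite generated_fieldE mxE. Qed.

Definition generated_field_entries := (generated_fieldE0, generated_fieldE1).

Lemma generated_fieldD xi eta z :
  generated_field (xi + eta) z = generated_field xi z + generated_field eta z.
Proof.
rewrite !generated_fieldE; apply/matrixP => k j; rewrite !mxE.
by case: (k == 0); ring.
Qed.

Lemma generated_field0 z : generated_field 0 z = 0.
Proof.
rewrite generated_fieldE; apply/matrixP => k j; rewrite !mxE !mul0r.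
by rewrite oppr0 if_same.
Qed.

Lemma torus_act_generated a xi z :
  torus_act a (generated_field xi z) = generated_field xi (torus_act a z).
Proof.
apply: eq_mx2 => j.
- rewrite generated_fieldE0 torus_actE0 torus_actE1 generated_fieldE0.
  by rewrite generated_fieldE1; ring.
- rewrite generated_fieldE1 torus_actE0 torus_actE1 generated_fieldE0.
  by rewrite generated_fieldE1; ring.
Qed.

(* With z_j = r_j e^{i theta_j}, the entries of [dmu z v] and [rot z v] are
   r_j dr_j(v) and r_j^2 dtheta_j(v). *)
Definition dmu z v : 'rV[R]_d := \row_j (z 0 j * v 0 j + z 1 j * v 1 j).
Definition rot z v : 'rV[R]_d := \row_j (z 0 j * v 1 j - z 1 j * v 0 j).
Definition sqnorm z j := z 0 j ^+ 2 + z 1 j ^+ 2.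

(** [dmu] and [rot] are the real and imaginary parts of conj(z_j) v_j, so v_j = z_j (p_j + i r_j) /
    |z_j|^2 inverts them where z_j is nonzero. *)
Definition polar z p r : 'M[R]_(2, d) := \matrix_(k, j)
  if k == 0 then (z 0 j * p 0 j - z 1 j * r 0 j) / sqnorm z j
  else (z 1 j * p 0 j + z 0 j * r 0 j) / sqnorm z j.

Lemma polarE0 z p r j :
  polar z p r 0 j = (z 0 j * p 0 j - z 1 j * r 0 j) / sqnorm z j.
Proof. by rewrite mxE. Qed.

Lemma polarE1 z p r j :
  polar z p r 1 j = (z 1 j * p 0 j + z 0 j * r 0 j) / sqnorm z j.
Proof. by rewrite mxE. Qed.

Lemma mulmx_row_col (x : 'rV[R]_d) (y : 'cV[R]_d) :
  (x *m y) 0 0 = \sum_j x 0 j * y j 0.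
Proof. by rewrite mxE. Qed.

Lemma sqnorm_mu z j : sqnorm z j = 2 * mu z 0 j.
Proof. by rewrite mxE mulrA divff ?mul1r// pnatr_eq0. Qed.

Lemma dmuDr z v w : dmu z (v + w) = dmu z v + dmu z w.
Proof. by apply/rowP => j; rewrite !mxE; ring. Qed.

Lemma rotDr z v w : rot z (v + w) = rot z v + rot z w.
Proof. by apply/rowP => j; rewrite !mxE; ring. Qed.

Lemma dmu_generated xi z : dmu z (generated_field xi z) = 0.
Proof. by apply/rowP => j; rewrite !mxE !generated_field_entries; ring. Qed.

Lemma rot_generated xi z :
  rot z (generated_field xi z) = \row_j (sqnorm z j * xi j 0).
Proof. by apply/rowP => j; rewrite !mxE !generated_field_entries /sqnorm; ring. Qed.

Lemma flat_generated z v xi :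
  flat_metric v (generated_field xi z) = (rot z v *m xi) 0 0.
Proof.
rewrite mulmx_row_col; apply: eq_bigr => j _.
by rewrite !generated_field_entries mxE; ring.
Qed.

(** Read from right to left, it inserts the factor that turns the rotation invariance of [mu], [dmu]
    and [rot] into ring identities. *)
Lemma cos2sin2M (a x y : R) :
  (cos a ^+ 2 + sin a ^+ 2) * (x + y) = x + y.
Proof. by rewrite cos2Dsin2 mul1r. Qed.

Lemma mu_act a z : mu (torus_act a z) = mu z.
Proof.
apply/rowP => j; rewrite !mxE/= -[in RHS](cos2sin2M (a j 0)); ring.
Qed.

Lemma dmu_act a z v : dmu (torus_act a z) (torus_act a v) = dmu z v.
Proof.
apply/rowP => j; rewrite !mxE/= -[in RHS](cos2sin2M (a j 0)); ring.
Qed.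

Lemma rot_act a z v : rot (torus_act a z) (torus_act a v) = rot z v.
Proof.
apply/rowP => j; rewrite !mxE/= -[in RHS](cos2sin2M (a j 0)); ring.
Qed.

Lemma N0 : N 0.
Proof. by exists 0; rewrite mulmx0 map_mx0 scaler0. Qed.

Lemma ND a b : N a -> N b -> N (a + b).
Proof.
by move=> [k ak] [l bl]; exists (k + l); rewrite mulmxDr ak bl map_mxD scalerDr.
Qed.

Lemma NN a : N a -> N (- a).
Proof. by move=> [k ak]; exists (- k); rewrite mulmxN ak map_mxN scalerN. Qed.

Lemma lieN0 : lieN 0. Proof. by rewrite /Defs.lieN /= mulmx0. Qed.

Lemma lieND xi eta : lieN xi -> lieN eta -> lieN (xi + eta).
Proof. by rewrite /Defs.lieN /= mulmxDr => -> ->; rewrite addr0. Qed.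

Lemma lieNN xi : lieN xi -> lieN (- xi).
Proof. by rewrite /Defs.lieN /= mulmxN => ->; rewrite oppr0. Qed.

Lemma q_mem z : q u z z.
Proof. by exists 0; [exact: N0 | rewrite torus_act0]. Qed.

Lemma q_act a z : N a -> q u (torus_act a z) = q u z.
Proof.
move=> Na; apply/seteqP; split => w /= [b Nb ->].
- by exists (b + a); [exact: ND | rewrite torus_act_comp].
- exists (b - a); first exact: ND Nb (NN Na).
  by rewrite torus_act_comp subrK.
Qed.

Lemma dq_mem z v : dq u z v (z, v).
Proof.
exists 0, 0; split; [exact: N0 | exact: lieN0 |].
by rewrite !torus_act0 generated_field0 addr0.
Qed.

Lemma dq_sub a xi z v : N a -> lieN xi ->
  dq u (torus_act a z) (torus_act a (v + generated_field xi z)) `<=` dq u z v.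
Proof.
move=> Na Lxi _ /= [b [eta [Nb Leta ->]]]; exists (b + a), (xi + eta).
split; [exact: ND | exact: lieND |].
rewrite -torus_act_generated -torus_actD !torus_act_comp.
by rewrite generated_fieldD addrA.
Qed.

(** The reverse inclusion is [dq_sub] again, applied to -a and -xi, which lead back from the new
    pair to (z, v). *)
Lemma dq_act a xi z v : N a -> lieN xi ->
  dq u (torus_act a z) (torus_act a (v + generated_field xi z)) = dq u z v.
Proof.
move=> Na Lxi; apply/seteqP; split; first exact: dq_sub.
set z' := torus_act a z; set v' := torus_act a _.
suff -> : dq u z v = dq u (torus_act (- a) z')
    (torus_act (- a) (v' + generated_field (- xi) z')).
  by apply: dq_sub; [exact: NN | exact: lieNN].
rewrite /z' /v' -torus_act_generated -torus_actD !torus_act_comp addNr !torus_act0.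
by rewrite -addrA -generated_fieldD subrr generated_field0 addr0.
Qed.

Lemma dq_eqP z v z' v' : dq u z v = dq u z' v' ->
  exists a xi, [/\ N a, lieN xi, z' = torus_act a z &
    v' = torus_act a (v + generated_field xi z)].
Proof.
move=> E; have := dq_mem z' v'; rewrite -E => -[a [xi [Na Lxi [-> ->]]]].
by exists a, xi; split; [exact: Na | exact: Lxi | | ].
Qed.

Section Nonzero.
Variable z : 'M[R]_(2, d).
Hypothesis z0 : forall j, 0 < sqnorm z j.

Let sn0 j : z 0 j ^+ 2 + z 1 j ^+ 2 != 0. Proof. exact: lt0r_neq0 (z0 j). Qed.

Lemma dmu_polar p r : dmu z (polar z p r) = p.
Proof.
by apply/rowP => j; rewrite mxE polarE0 polarE1 /sqnorm; field.
Qed.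

Lemma rot_polar p r : rot z (polar z p r) = r.
Proof.
by apply/rowP => j; rewrite mxE polarE0 polarE1 /sqnorm; field.
Qed.

Lemma polar_dmu_rot v : polar z (dmu z v) (rot z v) = v.
Proof.
by apply: eq_mx2 => j; rewrite ?polarE0 ?polarE1 !mxE /sqnorm; field.
Qed.

(** The polar form dr_j^2 + r_j^2 dtheta_j^2, expressed through r_j dr_j and r_j^2 dtheta_j. *)
Lemma flat_metricE v w : flat_metric v w = \sum_j
  (dmu z v 0 j * dmu z w 0 j + rot z v 0 j * rot z w 0 j) / sqnorm z j.
Proof. by apply: eq_bigr => j _; rewrite !mxE /sqnorm; field. Qed.

Lemma flat_formE v w : flat_form v w = \sum_j
  (dmu z v 0 j * rot z w 0 j - rot z v 0 j * dmu z w 0 j) / sqnorm z j.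
Proof. by apply: eq_bigr => j _; rewrite !mxE /sqnorm; field. Qed.

End Nonzero.
End TorusAction.

Lemma delta_mulmxE (R : pzRingType) m n (A : 'M[R]_(m, n)) i j :
  ((delta_mx 0 i : 'rV[R]_m) *m A) 0 j = A i j.
Proof.
rewrite mxE (bigD1 i)//= mxE !eqxx mul1r big1 ?addr0// => k /negPf ki.
by rewrite mxE ki mul0r.
Qed.

(** * The bilinear form B and the covectors it represents *)

Section MetricForm.
Context {R : realType} {n d : nat}.
Variables (u : 'M[int]_(n, d)) (lambda : 'rV[R]_d).
Local Notation U := (umx (R := R) u).
Local Notation ell := (ell u lambda).
Local Notation Delta0 := (Delta0 u lambda).
Local Notation lieN := (@lieN R n d u).

(** The annihilator of a kernel is a row space: the columns of [cokermx U] lie in ker u, and a row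
    killed by [cokermx U] is a combination of the rows of [U]. *)
Lemma annihilator_lieN (p : 'rV[R]_d) :
  (forall xi, lieN xi -> p *m xi = 0) <-> exists a, p = a *m U.
Proof.
split=> [H|[a ->] xi]; last by rewrite /Defs.lieN /= -mulmxA => ->; rewrite mulmx0.
apply/submxP; rewrite submxE; apply/eqP/rowP => j.
have /H : lieN (col j (cokermx U)).
  by rewrite /Defs.lieN /= colE mulmxA mulmx_coker mul0mx.
by rewrite colE mulmxA -colE => /colP/(_ 0); rewrite [LHS]mxE => ->; rewrite !mxE.
Qed.

Definition metric_form (x a b : 'rV[R]_n) : R :=
  \sum_j (a *m U) 0 j * (b *m U) 0 j / (2 * ell x 0 j).

Lemma metric_formC x a b : metric_form x a b = metric_form x b a.
Proof. by apply: eq_bigr => j _; rewrite [_ * (b *m U) 0 j]mulrC. Qed.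

Lemma metric_form_linear x t a b c :
  metric_form x (t *: a + b) c = t * metric_form x a c + metric_form x b c.
Proof.
rewrite /metric_form mulr_sumr -big_split/=; apply: eq_bigr => j _.
have -> : ((t *: a + b) *m U) 0 j = t * (a *m U) 0 j + (b *m U) 0 j.
  by rewrite mulmxDl -scalemxAl [LHS]mxE [X in X + _]mxE.
ring.
Qed.

Lemma metric_form0r x a : metric_form x a 0 = 0.
Proof. by apply: big1 => j _; rewrite mul0mx [(0 : 'rV_d) 0 j]mxE mulr0 mul0r. Qed.

Lemma metric_form0l x a : metric_form x 0 a = 0.
Proof. by rewrite metric_formC metric_form0r. Qed.

Lemma metric_formDr x a b c :
  metric_form x c (a + b) = metric_form x c a + metric_form x c b.
Proof.
by rewrite ![metric_form x c _]metric_formC -[a]scale1r metric_form_linear mul1r scale1r.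
Qed.

Lemma metric_formNr x a b : metric_form x a (- b) = - metric_form x a b.
Proof.
by apply/eqP; rewrite -addr_eq0 -metric_formDr addNr metric_form0r.
Qed.

Hypothesis hDelta : rational_Delzant u lambda.
Variable x : 'rV[R]_n.
Hypothesis Dx : Delta0 x.

Let l0 j : 0 < 2 * ell x 0 j.
Proof. by rewrite mulr_gt0//; exact: ell_gt0. Qed.

Let freeU : row_free U.
Proof. exact: row_free_umx (nbhs_singleton Dx). Qed.

(** All summands are nonnegative as l_j > 0; if they all vanish then a U = 0, and the u_j span. *)
Lemma metric_form_gt0 a : a != 0 -> 0 < metric_form x a a.
Proof.
move=> a0; have ge j : 0 <= (a *m U) 0 j * (a *m U) 0 j / (2 * ell x 0 j).
  by rewrite divr_ge0 ?(ltW (l0 j))// -expr2 sqr_ge0.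
rewrite lt_neqAle sumr_ge0// andbT eq_sym; apply: contra a0 => /eqP B0.
rewrite -(mulmx_free_eq0 _ freeU); apply/eqP/rowP => j; rewrite [RHS]mxE.
move: B0 => /eqP; rewrite psumr_eq0// => /allP/(_ j (mem_index_enum _)) /=.
by rewrite !mulf_eq0 invr_eq0 (gt_eqF (l0 j)) orbF orbb => /eqP.
Qed.

Lemma metric_form_nondegenerate a : (forall b, metric_form x b a = 0) -> a = 0.
Proof.
move=> Ba; apply/eqP/negPn/negP => /metric_form_gt0.
by rewrite Ba ltxx.
Qed.

(** The row c U is the orthogonal projection of [r] onto the row space of [U] for the weights 1 / (2
    l_j). The normal equations have the Gram matrix U D U^T, invertible because B is
    nondegenerate. *)
Lemma metric_form_represents (r : 'rV[R]_d) : exists c, forall b,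
  metric_form x b c = \sum_j (b *m U) 0 j * r 0 j / (2 * ell x 0 j).
Proof.
pose D := diag_mx (\row_j (2 * ell x 0 j)^-1).
have DE (p : 'rV[R]_d) b : (p *m D *m (b *m U)^T) 0 0 =
    \sum_j (b *m U) 0 j * p 0 j / (2 * ell x 0 j).
  rewrite mxE; apply: eq_bigr => j _.
  rewrite mul_mx_diag mxE [X in _ * X = _]mxE [X in _ * X * _]mxE; ring.
have SE c b : (c *m (U *m D *m U^T) *m b^T) 0 0 = metric_form x b c.
  by rewrite /metric_form -DE trmx_mul !mulmxA.
have Su : U *m D *m U^T \in unitmx.
  rewrite -row_free_unit; apply: inj_row_free => c cS0.
  apply: metric_form_nondegenerate => b; rewrite -SE cS0 mul0mx mxE//.
exists (r *m D *m U^T *m invmx (U *m D *m U^T)) => b.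
by rewrite -SE mulmxKV// -DE trmx_mul !mulmxA.
Qed.

End MetricForm.

Lemma is_derive_mu (R : realType) d (c : R -> 'M[R]_(2, d)) (t : R) v :
  is_derive t 1 c v -> is_derive t 1 (fun s => mu (c s)) (dmu (c t) v).
Proof.
move=> /is_derive_mxP dc; apply/is_derive_mxP => i j; rewrite mxE.
under eq_fun do rewrite mxE.
have := is_deriveZ 2^-1 (is_deriveD (is_deriveX 2 (dc 0 j)) (is_deriveX 2 (dc 1 j))).
rewrite !exprfctE => H; apply: (is_derive_eq H).
by rewrite -![_ *: _]/(_ * _) /=; field.
Qed.

(** * Tangent vectors of the quotient *)

Section Quotient.
Context {R : realType} {n d : nat}.
Variables (u : 'M[int]_(n, d)) (lambda : 'rV[R]_d).
Variable nu : orbit_class R d -> 'rV[R]_n.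
Hypothesis hDelta : rational_Delzant u lambda.
Hypothesis hnu : momentum_map u lambda nu.
Implicit Types (z v w : 'M[R]_(2, d)) (a b c : 'rV[R]_n).
Local Notation U := (umx (R := R) u).
Local Notation ell := (ell u lambda).
Local Notation Delta0 := (Delta0 u lambda).
Local Notation level := (level u lambda).
Local Notation level0 := (level0 u lambda nu).
Local Notation M0 := (M0 u lambda nu).
Local Notation TM := (TM u lambda nu).
Local Notation q := (q u).
Local Notation dq := (dq u).
Local Notation B := (metric_form u lambda).

Lemma level0_level z : level0 z -> level z. Proof. by case. Qed.

Lemma level0_Delta0 z : level0 z -> Delta0 (nu (q z)). Proof. by case=> _ []. Qed.

Lemma sqnorm_level z j : level z -> sqnorm z j = 2 * ell (nu (q z)) 0 j.
Proof. by move=> /hnu ->; rewrite sqnorm_mu. Qed.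

Lemma sqnorm_gt0 z j : level0 z -> 0 < sqnorm z j.
Proof.
move=> z0; rewrite (sqnorm_level _ (level0_level z0)) mulr_gt0//.
exact: ell_gt0 (level0_Delta0 z0).
Qed.

Lemma level0_row_free z : level0 z -> row_free U.
Proof. by move=> /level0_Delta0/nbhs_singleton/(row_free_umx hDelta). Qed.

(** The defining equation of [nu] is inverted explicitly, making [nu] an affine function of [mu]
    that can be differentiated along curves. *)
Lemma nuE z : row_free U -> level z -> nu (q z) = (mu z + lambda) *m pinvmx U.
Proof. by move=> fU /hnu <-; rewrite /Defs.ell subrK mulmxKp. Qed.

Lemma level0_M0 z : level0 z -> M0 (q z).
Proof. by case. Qed.

Lemma level0_ex x : Delta0 x -> exists z, level0 z /\ nu (q z) = x.
Proof.
move=> Dx; have fU := row_free_umx hDelta (nbhs_singleton Dx).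
(* The point with real coordinates z_j = sqrt(2 l_j), so that [mu z] equals [ell x]. *)
pose z : 'M[R]_(2, d) := \matrix_(k, j) if k == 0 then Num.sqrt (2 * ell x 0 j) else 0.
have muz : mu z = ell x.
  apply/rowP => j; rewrite mxE ![z _ _]mxE/= expr0n addr0 sqr_sqrtr.
    by rewrite mulrA mulVf ?mul1r ?pnatr_eq0.
  by rewrite mulr_ge0// ltW//; exact: ell_gt0.
have lz : level z.
  move=> xi xi0; rewrite muz /Defs.ell mulmxBl -mulmxA.
  by move: xi0; rewrite /Defs.lieN /= => ->; rewrite mulmx0 sub0r mulNmx.
have nuz : nu (q z) = x.
  by rewrite nuE// muz /Defs.ell subrK mulmxKp.
exists z; split => //; split => //; split; last by rewrite nuz.
by exists z.
Qed.

(** Along a curve in the level set the pairing of [mu] with any element of ker u is constant, so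
    [dmu z v] annihilates ker u. *)
Lemma tangent_dmu z v : level z -> tangent level z v -> exists a, dmu z v = a *m U.
Proof.
move=> lz [gamma [[lg dg] g0 g1]]; apply/annihilator_lieN => xi xi0.
have {dg g1}dg : is_derive (0 : R) 1 gamma v.
  by apply: DeriveDef; [exact: dg | rewrite -derive1E].
have := is_derive_mu dg; rewrite g0 => /is_derive_mxP dm.
have H : is_derive (0 : R) 1 (fun t => \sum_j mu (gamma t) 0 j * xi j 0)
   (\sum_j dmu z v 0 j * xi j 0).
  apply: is_derive_sum_fun => j.
  have := is_derive_prod (dm 0 j) (is_derive_cst (xi j 0) (0 : R) 1).
  by move/is_derive_eq; apply; rewrite mulr0 add0r mulrC.
have K : is_derive (0 : R) 1 (fun t => \sum_j mu (gamma t) 0 j * xi j 0) 0.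
  apply: (@near_eq_is_derive _ _ _ (cst ((- lambda *m xi) 0 0))).
    near=> t; rewrite -mulmx_row_col; have -> // : mu (gamma t) *m xi = - lambda *m xi.
    have lt : level (gamma t) by near: t; exact: lg.
    exact: lt.
apply/rowP => k; rewrite ord1 mulmx_row_col [RHS]mxE.
by have [_ <-] := H; have [_ ->] := K.
Unshelve. all: by end_near. Qed.

(* The velocity of a rotation combined with a radial motion along which mu is
   affine in time. *)
Lemma tangent_polar z a r : level z -> (forall j, 0 < sqnorm z j) ->
  tangent level z (polar z (a *m U) r).
Proof.
move=> lz sz; pose p := a *m U.
(* The radial factor for which |f_j z_j|^2 = |z_j|^2 + 2 t p_j, that is, [mu] becomes mu z + t p. *)
pose f j (t : R) := Num.sqrt (1 + t * (2 * p 0 j / sqnorm z j)).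
pose b : 'cV[R]_d := \col_j (r 0 j / sqnorm z j).
pose gamma (t : R) := torus_act (t *: b) (\matrix_(k, j) (f j t * z k j)).
have f0 j : f j 0 = 1 by rewrite /f mul0r addr0 sqrtr1.
have df j : is_derive (0 : R) 1 (f j) (p 0 j / sqnorm z j).
  have dl : is_derive (0 : R) 1 (fun t : R => 1 + t * (2 * p 0 j / sqnorm z j))
      (2 * p 0 j / sqnorm z j).
    have := is_deriveD (is_derive_cst (1 : R) (0 : R) 1) (is_derive_prod
      (is_derive_id (0 : R) 1) (is_derive_cst (2 * p 0 j / sqnorm z j) (0 : R) 1)).
    by move/is_derive_eq; apply; rewrite add0r mulr0 add0r mulr1.
  have s1 : (0 : R) < 1 + 0 * (2 * p 0 j / sqnorm z j) by rewrite mul0r addr0.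
  have := @is_derive_comp_scalar R R Num.sqrt _ 0 1 _ _ (is_derive1_sqrt s1) dl.
  move/is_derive_eq; apply; rewrite mul0r addr0 sqrtr1.
  by have := lt0r_neq0 (sz j); move: (sqnorm z j) => s s0; field.
have dg : is_derive (0 : R) 1 gamma (polar z p r).
  have dZ : is_derive (0 : R) 1 (fun t => \matrix_(k, j) (f j t * z k j) : 'M[R]_(2, d))
      (\matrix_(k, j) (p 0 j / sqnorm z j * z k j)).
    apply/is_derive_mxP => k j; rewrite mxE; under eq_fun do rewrite mxE.
    have := is_derive_prod (df j) (is_derive_cst (z k j) (0 : R) 1).
    by move/is_derive_eq; apply; rewrite mulr0 add0r mulrC.
  have := is_derive_torus_act b dZ; move/is_derive_eq; apply.
  by apply: eq_mx2 => j; rewrite [LHS]mxE generated_field_entries (polarE0, polarE1);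
    rewrite !mxE f0 !mul1r; ring.
exists gamma; split.
- split; last by case: dg.
  (* The square roots square back to their arguments only while these are nonnegative, so the curve
     is shown to stay in the level set for small t. *)
  have pos : \forall t \near (0 : R), forall j, 0 < 1 + t * (2 * p 0 j / sqnorm z j).
    suff H j : \forall t \near (0 : R), 0 < 1 + t * (2 * p 0 j / sqnorm z j).
      exact: filter_forall H.
    have c : (1 + t * (2 * p 0 j / sqnorm z j)) @[t --> (0 : R)] -->
        1 + 0 * (2 * p 0 j / sqnorm z j).
      by apply: cvgD; [exact: cvg_cst | apply: cvgM; [exact: cvg_id | exact: cvg_cst]].
    by apply: (cvgr_gt _ c); rewrite mul0r addr0.
  near=> t => xi xi0.
  have -> : mu (gamma t) = mu z + t *: p.
    rewrite mu_act; apply/rowP => j.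
    have ft : f j t ^+ 2 = 1 + t * (2 * p 0 j / sqnorm z j).
      by rewrite sqr_sqrtr// ltW//; move: j; near: t; exact: pos.
    rewrite [LHS]mxE ![(\matrix_(_, _) _) _ j]mxE !exprMn ft.
    rewrite [RHS]mxE [mu z 0 j]mxE [(t *: p) 0 j]mxE.
    by have := lt0r_neq0 (sz j); rewrite /sqnorm => s0; field.
  rewrite mulmxDl (lz _ xi0) -scalemxAl -mulmxA.
  by move: xi0; rewrite /Defs.lieN/= => ->; rewrite mulmx0 scaler0 addr0.
- rewrite /gamma scale0r torus_act0; apply/matrixP => k j.
  by rewrite mxE f0 mul1r.
- by rewrite derive1E; case: dg.
Unshelve. all: by end_near. Qed.

End Quotient.

(** * Horizontal representatives and the structures of the quotient *)

Section QuotientTangent.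
Context {R : realType} {n d : nat}.
Variables (u : 'M[int]_(n, d)) (lambda : 'rV[R]_d).
Variable nu : orbit_class R d -> 'rV[R]_n.
Hypothesis hDelta : rational_Delzant u lambda.
Hypothesis hnu : momentum_map u lambda nu.
Implicit Types (z v w : 'M[R]_(2, d)) (a b c : 'rV[R]_n).
Local Notation U := (umx (R := R) u).
Local Notation ell := (ell u lambda).
Local Notation Delta0 := (Delta0 u lambda).
Local Notation level := (level u lambda).
Local Notation level0 := (level0 u lambda nu).
Local Notation M0 := (M0 u lambda nu).
Local Notation TM := (TM u lambda nu).
Local Notation q := (q u).
Local Notation dq := (dq u).
Local Notation B := (metric_form u lambda).


Let sqnorm_level0 z : level0 z -> forall j, 0 < sqnorm z j.
Proof. by move=> z0 j; apply: (sqnorm_gt0 hDelta hnu j z0). Qed.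

Lemma is_derive_nu (W : normedModType R) (Phi : 'rV[R]_n -> W) (gamma : R -> 'M[R]_(2, d)) a :
  row_free U -> curve_in level gamma ->
  dmu (gamma 0) (derive1 gamma 0) = a *m U ->
  differentiable Phi (nu (q (gamma 0))) ->
  is_derive (0 : R) 1 ((Phi \o nu) \o q \o gamma) ('D_a Phi (nu (q (gamma 0)))).
Proof.
move=> fU [lg dg] da dPhi.
have gE t : level (gamma t) -> nu (q (gamma t)) = (mu (gamma t) + lambda) *m pinvmx U.
  exact: nuE.
have dc : is_derive (0 : R) 1 (fun t => (mu (gamma t) + lambda) *m pinvmx U) a.
  have dm : is_derive (0 : R) 1 (fun t => mu (gamma t)) (a *m U).
    rewrite -da; apply: is_derive_mu.
    by apply: DeriveDef; [exact: dg | rewrite derive1E].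
  apply/is_derive_mxP => i j; under eq_fun do rewrite mxE.
  rewrite -[a](mulmxKp fU) [(_ *m pinvmx U) i j]mxE.
  apply: is_derive_sum_fun => k; under eq_fun do rewrite [X in X * _]mxE.
  have /is_derive_mxP dmk := dm.
  have := is_derive_prod (is_deriveD (dmk i k) (is_derive_cst (lambda i k) (0 : R) 1))
    (is_derive_cst (pinvmx U k j) (0 : R) 1).
  by move/is_derive_eq; apply; rewrite mulr0 add0r addr0 mulrC.
rewrite gE; last exact: nbhs_singleton lg.
apply: (@near_eq_is_derive _ _ _ (Phi \o (fun t => (mu (gamma t) + lambda) *m pinvmx U))).
  near=> t; rewrite /= gE//.
  by near: t; exact: lg.
apply: derive_curve_comp => //.
by rewrite -gE//; exact: nbhs_singleton lg.
Unshelve. all: by end_near. Qed.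

(** [dM] picks some value, so uniqueness is the point: another curve with velocity in the same class
    starts at an N-translate of [z], and its velocity differs by that translation and a generated
    vector, neither of which affects [nu] or [dmu]. Identity and [F] are the maps [Phi] of
    interest. *)
Lemma dM_comp (W : normedModType R) (Phi : 'rV[R]_n -> W) z v a :
  level0 z -> tangent level z v -> dmu z v = a *m U ->
  differentiable Phi (nu (q z)) ->
  dM u lambda (Phi \o nu) (dq z v) = 'D_a Phi (nu (q z)).
Proof.
move=> z0 [gamma [cg g0 g1]] da dPhi.
have fU := level0_row_free hDelta z0.
apply: xget_unique.
  exists gamma; split; [exact: cg | by rewrite g0 g1 |].
  have da' : dmu (gamma 0) (derive1 gamma 0) = a *m U by rewrite g0 g1.
  have := is_derive_nu fU cg da'; rewrite g0; apply; exact: dPhi.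
move=> w [e [ce /dq_eqP[b [xi [Nb Lxi e0 e1]]] dw]].
have qe : q (e 0) = q z by rewrite e0 q_act.
have da' : dmu (e 0) (derive1 e 0) = a *m U.
  by rewrite e0 e1 dmu_act dmuDr dmu_generated addr0.
have := is_derive_nu fU ce da'; rewrite qe => /(_ _ _ dPhi) dw'.
by rewrite -(@derive_val _ _ _ _ _ _ _ dw) (@derive_val _ _ _ _ _ _ _ dw').
Qed.

Lemma dM_nu z v a : level0 z -> tangent level z v -> dmu z v = a *m U ->
  dM u lambda nu (dq z v) = a.
Proof.
move=> z0 tv da; have := @dM_comp _ id z v a z0 tv da.
by rewrite derive_id => ->.
Qed.

(* The horizontal vector with d(nu) = a and angular velocities given by c, in
   the coordinates where both are covectors on R^n. *)
Definition hlift z a c : 'M[R]_(2, d) := polar z (a *m U) (c *m U).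

Lemma dmu_hlift z a c : level0 z -> dmu z (hlift z a c) = a *m U.
Proof. by move=> z0; exact/dmu_polar/(sqnorm_level0 z0). Qed.

Lemma rot_hlift z a c : level0 z -> rot z (hlift z a c) = c *m U.
Proof. by move=> z0; exact/rot_polar/(sqnorm_level0 z0). Qed.

Lemma tangent_hlift z a c : level0 z -> tangent level z (hlift z a c).
Proof.
move=> z0; apply: tangent_polar; first exact: level0_level z0.
exact: sqnorm_level0 z0.
Qed.

Lemma horizontal_hlift z a c : level0 z -> horizontal u lambda z (hlift z a c).
Proof.
move=> z0; split; first exact: tangent_hlift.
move=> xi; rewrite /Defs.lieN /= => xi0.
by rewrite flat_generated rot_hlift// -mulmxA xi0 mulmx0 mxE.
Qed.

(** A vector tangent to the N-orbit is added to make [v] horizontal. The last clause recovers B(.,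
    c) from [v] itself, so c can later be eliminated. *)
Lemma dq_hlift z v : level0 z -> tangent level z v -> exists a c,
  [/\ dq z v = dq z (hlift z a c), dmu z v = a *m U &
      forall b, B (nu (q z)) b c = \sum_j (b *m U) 0 j * rot z v 0 j / sqnorm z j].
Proof.
move=> z0 tv; have lz := level0_level z0.
have [a da] := tangent_dmu lz tv.
have sz := sqnorm_level0 z0.
have [c Bc] := metric_form_represents hDelta (level0_Delta0 z0) (rot z v).
have sE j : sqnorm z j = 2 * ell (nu (q z)) 0 j by exact: sqnorm_level.
exists a, c; split => //; last first.
  by move=> b; rewrite Bc; apply: eq_bigr => j _; rewrite sE.
pose xi : 'cV[R]_d := \col_j (((c *m U) 0 j - rot z v 0 j) / sqnorm z j).
(* The equation for c, tested on the basis covectors, says exactly that the correction of the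
   angular velocities lies in ker u. *)
have Lxi : lieN u xi.
  apply/colP => i; rewrite [RHS]mxE; have := Bc (delta_mx 0 i).
  rewrite /metric_form => /eqP; rewrite -subr_eq0 -sumrB => /eqP E.
  rewrite -[RHS]E [LHS]mxE; apply: eq_bigr => j _.
  by rewrite delta_mulmxE [xi j 0]mxE sE; ring.
rewrite -(dq_act z v (@N0 R n d u) Lxi) !torus_act0; congr (Defs.dq u z _).
rewrite -[LHS](polar_dmu_rot sz) /hlift; congr (polar z _ _).
  by rewrite dmuDr dmu_generated addr0.
rewrite rotDr rot_generated; apply/rowP => j; rewrite [LHS]mxE [X in _ + X]mxE.
rewrite [xi j 0]mxE; have := lt0r_neq0 (sz j); move: (sqnorm z j) => s s0.
by field.
Qed.

Lemma TM_hlift z a c : level0 z -> TM (q z) (dq z (hlift z a c)).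
Proof.
by move=> z0; exists z, (hlift z a c); split => //; exact: tangent_hlift.
Qed.

(** A class may be presented over another point of the N-orbit; the rotation that brings it over [z]
    preserves [dmu] and [rot], hence the pair (a, c). *)
Lemma TM_P z X : level0 z -> TM (q z) X -> exists a c, X = dq z (hlift z a c).
Proof.
move=> z0 [w [v [w0 /esym qwz tv ->]]].
have : q z z by exact: q_mem.
rewrite -qwz => -[b Nb zE].
have [a [c [-> da Bc]]] := dq_hlift w0 tv.
exists a, c.
rewrite -(dq_act _ _ Nb (@lieN0 R n d u)) generated_field0 addr0 -zE.
congr (Defs.dq u z _).
have sz := sqnorm_level0 z0.
rewrite -[LHS](polar_dmu_rot sz) /hlift; congr (polar z _ _).
  by rewrite {1}zE dmu_act dmu_hlift.
by rewrite {1}zE rot_act rot_hlift.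
Qed.

Lemma dM_nu_hlift z a c : level0 z -> dM u lambda nu (dq z (hlift z a c)) = a.
Proof.
by move=> z0; apply: dM_nu; rewrite ?dmu_hlift//; exact: tangent_hlift.
Qed.

Section Structures.
Variables (omega g : tangent_class R d -> tangent_class R d -> R).
Variable J : tangent_class R d -> tangent_class R d.
Hypothesis homega : reduced_symplectic_form u lambda nu omega.
Hypothesis hg : Guillemin_metric u lambda nu g.
Hypothesis hJ : complex_structure u lambda nu omega g J.

Lemma g_hlift z a c a' c' : level0 z ->
  g (dq z (hlift z a c)) (dq z (hlift z a' c')) =
  B (nu (q z)) a a' + B (nu (q z)) c c'.
Proof.
move=> z0; rewrite hg//; try exact: horizontal_hlift.
have sz := sqnorm_level0 z0.
rewrite (flat_metricE sz) /metric_form -big_split/=; apply: eq_bigr => j _.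
by rewrite !dmu_hlift// !rot_hlift// (sqnorm_level hnu _ (level0_level z0)) mulrDl.
Qed.

Lemma omega_hlift z a c a' c' : level0 z ->
  omega (dq z (hlift z a c)) (dq z (hlift z a' c')) =
  B (nu (q z)) a c' - B (nu (q z)) c a'.
Proof.
move=> z0; rewrite homega//; try exact: tangent_hlift.
have sz := sqnorm_level0 z0.
rewrite (flat_formE sz) /metric_form -sumrB/=; apply: eq_bigr => j _.
by rewrite !dmu_hlift// !rot_hlift// (sqnorm_level hnu _ (level0_level z0)) mulrBl.
Qed.

(** Let a'' be the first component of J (a, c). Pairing with (0, b) gives B(b, c) for [g] and -B(b,
    a'') for [omega], and nondegeneracy forces a'' = -c. *)
Lemma J_hlift z a c : level0 z ->
  exists c', J (dq z (hlift z a c)) = dq z (hlift z (- c) c').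
Proof.
move=> z0; have M0z : M0 (q z) by case: z0.
have [TJ gJ] := hJ M0z (TM_hlift a c z0).
have [a'' [c'' JE]] := TM_P z0 TJ.
suff aE : a'' = - c by exists c''; rewrite JE aE.
apply/eqP; rewrite -addr_eq0; apply/eqP.
apply: (metric_form_nondegenerate hDelta (level0_Delta0 z0)) => b.
have := gJ _ (TM_hlift 0 b z0).
rewrite JE g_hlift// omega_hlift// !metric_form0l add0r sub0r => E.
by rewrite metric_formDr E addrN.
Qed.

(** The kernel of d(nu) consists of the vectors (0, b), and g((a, c), (0, b)) = B(c, b) vanishes for
    all b only if c = 0. *)
Lemma nu_horizontalP z X : level0 z -> nu_horizontal u lambda nu g (q z) X <->
  exists a, X = dq z (hlift z a 0).
Proof.
move=> z0; split=> [[/(TM_P z0)[a [c ->]] H]|[a ->]].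
  exists a; congr (Defs.dq u z (hlift z _ _)).
  apply: (metric_form_nondegenerate hDelta (level0_Delta0 z0)) => b.
  have := H _ (TM_hlift 0 b z0); rewrite dM_nu_hlift// => /(_ erefl).
  by rewrite g_hlift// metric_form0r add0r metric_formC.
split; first exact: TM_hlift.
move=> Y /(TM_P z0)[a' [c' ->]]; rewrite dM_nu_hlift// => ->.
by rewrite g_hlift// metric_form0r metric_form0l addr0.
Qed.

End Structures.

End QuotientTangent.

(** * Potentials *)

Section EllCalculus.
Context {R : realType} {n d : nat}.
Variables (u : 'M[int]_(n, d)) (lambda : 'rV[R]_d).
Implicit Types (x y v a b : 'rV[R]_n).
Local Notation U := (umx (R := R) u).
Local Notation ell := (ell u lambda).
Local Notation Delta0 := (Delta0 u lambda).
Local Notation B := (metric_form u lambda).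

Lemma is_derive_ell x v j : is_derive x v (fun y => ell y 0 j) ((v *m U) 0 j).
Proof.
apply/is_derive_lineP.
have -> : (fun h : R => ell (h *: v + x) 0 j) = (fun h => h * (v *m U) 0 j + ell x 0 j).
  by apply/funext => h; rewrite addrC ell_add addrC [LHS]mxE [X in X + _]mxE.
have := is_deriveD (is_derive_prod (is_derive_id (0 : R) 1)
  (is_derive_cst ((v *m U) 0 j) (0 : R) 1)) (is_derive_cst (ell x 0 j) (0 : R) 1).
by move/is_derive_eq; apply; rewrite mulr0 add0r addr0 mulr1.
Qed.

Lemma differentiable_ell x j : differentiable (fun y => ell y 0 j) x.
Proof.
have -> : (fun y => ell y 0 j) =
    \sum_(k < n) (fun y => y 0 k * U k j) - cst (lambda 0 j).
  by apply/funext => y; rewrite !mxE fctE fct_sumE.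
apply: differentiableB; last exact: differentiable_cst.
apply: differentiable_sum => k; apply: differentiableM.
  exact: differentiable_coord.
exact: differentiable_cst.
Qed.

Lemma continuous_ell j : continuous (fun y => ell y 0 j).
Proof. by move=> x; apply: differentiable_continuous; exact: differentiable_ell. Qed.

Lemma metric_formE x a b : B x a b = 2^-1 * \sum_(j < d)
  ('D_a (fun y => ell y 0 j) x * 'D_b (fun y => ell y 0 j) x) / ell x 0 j.
Proof.
rewrite mulr_sumr; apply: eq_bigr => j _.
have [_ ->] := is_derive_ell x a j; have [_ ->] := is_derive_ell x b j.
by rewrite invfM mulrCA.
Qed.

Definition dual_potential_fun x := 2^-1 * \sum_(j < d) ell x 0 j * ln (ell x 0 j).

Definition Kaehler_potential_fun x :=
  2^-1 * \sum_(j < d) (lambda 0 j * ln (ell x 0 j) + ell x 0 j).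

Hypothesis hDelta : rational_Delzant u lambda.

Lemma smooth_on_sum_ell (phi : 'I_d -> R -> R) (c : 'I_d -> R) (f : 'rV[R]_n -> R) :
  (forall j, scalar_smooth (phi j)) ->
  (forall x, Delta0 x -> f x = \sum_j c j * phi j (ell x 0 j)) ->
  smooth_on Delta0 f.
Proof.
apply: (@smooth_on_sum_scalar R 'rV[R]_n d Delta0 (fun x j => ell x 0 j)
  (fun v j => (v *m U) 0 j)).
- exact: open_interior.
- by move=> x j; exact: ell_gt0.
- exact: continuous_ell.
- exact: is_derive_ell.
Qed.

Lemma scalar_smooth_ln : scalar_smooth (@ln R).
Proof.
exact: (scalar_smooth_integral (fun t t0 => is_derive1_ln t0) scalar_smooth_inv).
Qed.

Lemma scalar_smooth_id : scalar_smooth (@id R).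
Proof.
exact: (scalar_smooth_integral (fun t _ => is_derive_id t 1) (scalar_smooth_cst 1)).
Qed.

(** The derivative ln t + 1 is left in the unsimplified shape that [scalar_smooth_comb] produces
    with coefficients 1. *)
Lemma is_derive_xlnx (t : R) : 0 < t ->
  is_derive t 1 (fun s => s * ln s) (1 * ln t + 1 * 1).
Proof.
move=> t0; have := is_derive_prod (is_derive_id t 1) (is_derive1_ln t0).
move/is_derive_eq; apply; have := lt0r_neq0 t0 => tn0.
by rewrite mulfV// mulr1 mul1r mulr1 addrC.
Qed.

Lemma scalar_smooth_xlnx : scalar_smooth (fun t : R => t * ln t).
Proof.
apply: (scalar_smooth_integral is_derive_xlnx).
exact: (scalar_smooth_comb 1 1 scalar_smooth_ln (scalar_smooth_cst 1)).
Qed.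

Lemma smooth_metric_form a b : smooth_on Delta0 (fun x => B x a b).
Proof.
apply: (@smooth_on_sum_ell (fun _ t => t^-1)
  (fun j => (a *m U) 0 j * (b *m U) 0 j / 2)) => [j|x _].
  exact: scalar_smooth_inv.
by apply: eq_bigr => j _; rewrite invfM mulrA.
Qed.

Lemma smooth_dual_potential : smooth_on Delta0 dual_potential_fun.
Proof.
apply: (@smooth_on_sum_ell (fun _ t => t * ln t) (fun=> 2^-1)) => [j|x _].
  exact: scalar_smooth_xlnx.
exact: mulr_sumr.
Qed.

Lemma smooth_Kaehler_potential : smooth_on Delta0 Kaehler_potential_fun.
Proof.
apply: (@smooth_on_sum_ell (fun j t => lambda 0 j * ln t + 1 * id t) (fun=> 2^-1)).
  move=> j; apply: scalar_smooth_comb; [exact: scalar_smooth_ln | exact: scalar_smooth_id].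
move=> x _; rewrite /Kaehler_potential_fun mulr_sumr.
by apply: eq_bigr => j _; rewrite mul1r.
Qed.

Lemma derive2_dual_potential x a b : Delta0 x ->
  'D_a ('D_b dual_potential_fun) x = B x a b.
Proof.
move=> Dx.
have d1 y : Delta0 y -> is_derive y b dual_potential_fun
    (2^-1 * \sum_j (1 * ln (ell y 0 j) + 1 * 1) * (b *m U) 0 j).
  move=> Dy; apply: is_deriveZ; apply: is_derive_sum_fun => j.
  exact: is_derive_comp_scalar (is_derive_xlnx (ell_gt0 hDelta j Dy)) (is_derive_ell y b j).
(* A second derivative at x needs the formula for the first one on a neighbourhood of x, available
   because Delta_0 is open. *)
have E : \near x, 2^-1 * \sum_j (1 * ln (ell x 0 j) + 1 * 1) * (b *m U) 0 j =
    'D_b dual_potential_fun x.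
  near=> y; have [] // := d1 y _.
  by near: y; apply: open_nbhs_nbhs; split => //; exact: open_interior.
rewrite -(near_eq_derive _ E).
have d2 : is_derive x a (fun y => 2^-1 * \sum_j (1 * ln (ell y 0 j) + 1 * 1) * (b *m U) 0 j)
    (2^-1 * \sum_j (b *m U) 0 j * ((ell x 0 j)^-1 * (a *m U) 0 j)).
  apply: is_deriveZ; apply: is_derive_sum_fun => j.
  have dl := is_derive_comp_scalar (is_derive1_ln (ell_gt0 hDelta j Dx)) (is_derive_ell x a j).
  have := is_derive_prod (is_deriveD (is_deriveZ 1 dl) (is_derive_cst (1 * 1 : R) x a))
    (is_derive_cst ((b *m U) 0 j) x a).
  by move/is_derive_eq; apply; rewrite mulr0 add0r addr0 -[1 *: _]/(1 * _) mul1r.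
have [_ ->] := d2; rewrite mulr_sumr; apply: eq_bigr => j _.
by rewrite invfM; ring.
Unshelve. all: by end_near. Qed.

Lemma hessian_dual_potential x a b : Delta0 x ->
  hessian dual_potential_fun x a b = B x a b.
Proof.
move=> Dx; rewrite /hessian.
under eq_bigr => r _ do under eq_bigr => s _ do
  rewrite derive2_dual_potential// /metric_form !mulr_suml.
under eq_bigr => r _ do rewrite exchange_big/=.
rewrite exchange_big/=; apply: eq_bigr => j _.
rewrite [(a *m U) 0 j]mxE [(b *m U) 0 j]mxE big_distrlr/= mulr_suml.
apply: eq_bigr => r _; rewrite mulr_suml; apply: eq_bigr => s _.
by rewrite !delta_mulmxE; ring.
Qed.

(** Differentiation gives the coefficients (lambda_j / l_j + 1) / 2 = <x, u_j> / (2 l_j), since l_j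
    + lambda_j = <x, u_j>; this is what the summand l_j in F achieves. *)
Lemma is_derive_Kaehler_potential x a : Delta0 x ->
  is_derive x a Kaehler_potential_fun (B x x a).
Proof.
move=> Dx.
have l0 j := ell_gt0 hDelta j Dx.
have dj j : is_derive x a (fun y => lambda 0 j * ln (ell y 0 j) + ell y 0 j)
    (lambda 0 j * ((ell x 0 j)^-1 * (a *m U) 0 j) + (a *m U) 0 j).
  have dl := is_derive_comp_scalar (is_derive1_ln (l0 j)) (is_derive_ell x a j).
  exact: is_deriveD (is_deriveZ (lambda 0 j) dl) (is_derive_ell x a j).
apply: (is_derive_eq (is_deriveZ 2^-1 (is_derive_sum_fun dj))).
rewrite -[_ *: _]/(_ * _) mulr_sumr; apply: eq_bigr => j _.
have -> : (x *m U) 0 j = ell x 0 j + lambda 0 j.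
  by rewrite -[ell x]/(x *m U - lambda) !mxE subrK.
by have := lt0r_neq0 (l0 j); move: (ell x 0 j) => e e0; field.
Qed.

Lemma differentiable_Kaehler_potential x : Delta0 x ->
  differentiable Kaehler_potential_fun x.
Proof.
move=> Dx.
have -> : Kaehler_potential_fun = 2^-1 *: \sum_(j < d)
    (lambda 0 j *: (fun y => ln (ell y 0 j)) + (fun y => ell y 0 j)).
  by apply/funext => y; rewrite /Kaehler_potential_fun fctE fct_sumE.
apply: differentiableZ; apply: differentiable_sum => j.
apply: differentiableD; last exact: differentiable_ell.
apply: differentiableZ; apply: (@differentiable_comp _ _ _ _ _ (@ln R)).
  exact: differentiable_ell.
by apply/derivable1_diffP; have [] := is_derive1_ln (ell_gt0 hDelta j Dx).
Qed.

End EllCalculus.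

Section Potentials.
Context {R : realType} {n d : nat}.
Variables (u : 'M[int]_(n, d)) (lambda : 'rV[R]_d).
Variable nu : orbit_class R d -> 'rV[R]_n.
Hypothesis hDelta : rational_Delzant u lambda.
Hypothesis hnu : momentum_map u lambda nu.
Implicit Types (z v w : 'M[R]_(2, d)) (a b c : 'rV[R]_n).
Local Notation U := (umx (R := R) u).
Local Notation ell := (ell u lambda).
Local Notation Delta0 := (Delta0 u lambda).
Local Notation level := (level u lambda).
Local Notation level0 := (level0 u lambda nu).
Local Notation M0 := (M0 u lambda nu).
Local Notation TM := (TM u lambda nu).
Local Notation q := (q u).
Local Notation dq := (dq u).
Local Notation B := (metric_form u lambda).


(** Every x in Delta_0 is a value of [nu] and every a lifts to the horizontal vector (a, 0), which
    determines h; conversely B has all the required properties. *)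
Lemma reduced_metricP (g : tangent_class R d -> tangent_class R d -> R)
    (h : 'rV[R]_n -> 'rV[R]_n -> 'rV[R]_n -> R) :
  Guillemin_metric u lambda nu g ->
  reduced_metric u lambda nu g h <-> forall x, Delta0 x -> forall a b, h x a b = B x a b.
Proof.
move=> hg; split=> [[_ H] x Dx a b|H].
  have [z [z0 zx]] := level0_ex hDelta hnu Dx.
  have [_ hz] := H _ (level0_M0 z0).
  have hE a' : nu_horizontal u lambda nu g (q z) (dq z (hlift u z a' 0)).
    by apply/(nu_horizontalP hDelta hnu hg _ z0); exists a'.
  have := hz _ _ (hE a) (hE b).
  rewrite !(dM_nu_hlift hDelta hnu)// (g_hlift hDelta hnu hg)// zx.
  by rewrite metric_form0r addr0.
split.
  split=> [x Dx|a b].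
    split=> [a b|t a b c|a a0]; rewrite !H//.
    - exact: metric_formC.
    - exact: metric_form_linear.
    - exact: metric_form_gt0 a0.
  apply: (smooth_on_eq (open_interior _) _ (smooth_metric_form hDelta a b)).
  by move=> x Dx; rewrite H.
move=> _ [[z lz <-] Dz].
have z0 : level0 z by split => //; split => //; exists z.
split=> [a|X Y].
  exists (dq z (hlift u z a 0)); first exact: TM_hlift.
  exact: dM_nu_hlift.
move=> /(nu_horizontalP hDelta hnu hg _ z0)[a ->].
move=> /(nu_horizontalP hDelta hnu hg _ z0)[b ->].
rewrite !(dM_nu_hlift hDelta hnu)// (g_hlift hDelta hnu hg)// H//.
by rewrite metric_form0r addr0.
Qed.

(** * The Kähler potential: d^c F and its exterior derivative *)

Section KaehlerPotential.
Variables (omega g : tangent_class R d -> tangent_class R d -> R).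
Variable J : tangent_class R d -> tangent_class R d.
Hypothesis homega : reduced_symplectic_form u lambda nu omega.
Hypothesis hg : Guillemin_metric u lambda nu g.
Hypothesis hJ : complex_structure u lambda nu omega g J.
Local Notation F := (Kaehler_potential_fun u lambda).

(** Here -dF(-c) = B(x, c) = sum_j <x, u_j> dtheta_j, and <x, u_j> / r_j^2 = 1/2 + lambda_j / r_j^2.
    The result mentions only z and v, not the chosen lift. *)
Lemma dc_Kaehler_potential z v : level0 z -> tangent level z v ->
  dc u lambda J (F \o nu) (dq z v) =
  \sum_j (2^-1 + lambda 0 j / sqnorm z j) * rot z v 0 j.
Proof.
move=> z0 tv; have Dx := level0_Delta0 z0.
have [a [c [-> _ Bc]]] := dq_hlift hDelta hnu z0 tv.
have [c' Jc] := J_hlift hDelta hnu homega hg hJ a c z0.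
have := @dM_comp _ _ _ _ _ _ hDelta hnu _ F z (hlift u z (- c) c') (- c) z0.
rewrite /dc Jc => ->; first last.
- exact: differentiable_Kaehler_potential.
- exact: (dmu_hlift hDelta hnu _ _ z0).
- exact: (tangent_hlift hDelta hnu _ _ z0).
have [_ ->] := is_derive_Kaehler_potential hDelta (- c) Dx.
rewrite metric_formNr opprK Bc; apply: eq_bigr => j _.
have -> : (nu (q z) *m U) 0 j = 2^-1 * sqnorm z j + lambda 0 j.
  rewrite (sqnorm_level hnu _ (level0_level z0)) mulKf ?pnatr_eq0//.
  by rewrite -[ell _]/(_ *m U - lambda) !mxE subrK.
have := lt0r_neq0 (sqnorm_gt0 hDelta hnu j z0).
by move: (sqnorm z j) => s s0; field.
Qed.

(** One summand of d^c F along a family: (x, y) is z_j and (p, r) the j-th component of the tangent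
    vector. *)
Lemma is_derive_angular (V : normedModType R) (x y p r : V -> R) t e x' y' p' r' (l : R) :
  0 < x t ^+ 2 + y t ^+ 2 ->
  is_derive t e x x' -> is_derive t e y y' -> is_derive t e p p' -> is_derive t e r r' ->
  is_derive t e (fun s => (2^-1 + l / (x s ^+ 2 + y s ^+ 2)) * (x s * r s - y s * p s))
    ((2^-1 + l / (x t ^+ 2 + y t ^+ 2)) * (x' * r t + x t * r' - y' * p t - y t * p') +
     (x t * r t - y t * p t) *
       (- (l * 2 * (x t * x' + y t * y')) / (x t ^+ 2 + y t ^+ 2) ^+ 2)).
Proof.
move=> s0 dx dy dp dr; have sn0 := lt0r_neq0 s0.
have ds : is_derive t e (fun s => x s ^+ 2 + y s ^+ 2) (2 * (x t * x' + y t * y')).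
  have := is_deriveD (is_deriveX 2 dx) (is_deriveX 2 dy); rewrite !exprfctE.
  by move/is_derive_eq; apply; rewrite /= -![_ *: _]/(_ * _); ring.
have di := @is_derive_inv R V (fun s => x s ^+ 2 + y s ^+ 2) t e _ sn0 ds.
have dl := is_deriveD (is_derive_cst (2^-1 : R) t e) (is_deriveZ l di).
have dw := is_deriveB (is_derive_prod dx dr) (is_derive_prod dy dp).
apply: (is_derive_eq (is_derive_prod dl dw)).
rewrite -[(cst _ + _) t]/(2^-1 + l * (x t ^+ 2 + y t ^+ 2)^-1).
rewrite -[((fun=> _) - _) t]/(x t * r t - y t * p t) -[l *: _]/(l * _).
by field.
Qed.

(** The identity d((r^2 / 2 + l) dtheta) = r dr /\ dtheta in coordinates: mixed second derivatives
    cancel by symmetry, and the terms in l cancel because dtheta is closed away from the origin. *)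
Lemma angular_identity (l x y x1 y1 x2 y2 x12 y12 x21 y21 : R) :
  x ^+ 2 + y ^+ 2 != 0 -> x12 = x21 -> y12 = y21 ->
  x1 * y2 - y1 * x2 =
  ((2^-1 + l / (x ^+ 2 + y ^+ 2)) * (x1 * y2 + x * y12 - y1 * x2 - y * x12) +
   (x * y2 - y * x2) * (- (l * 2 * (x * x1 + y * y1)) / (x ^+ 2 + y ^+ 2) ^+ 2)) -
  ((2^-1 + l / (x ^+ 2 + y ^+ 2)) * (x2 * y1 + x * y21 - y2 * x1 - y * x21) +
   (x * y1 - y * x1) * (- (l * 2 * (x * x2 + y * y2)) / (x ^+ 2 + y ^+ 2) ^+ 2)).
Proof. by move=> s0 -> ->; field. Qed.

(** Pulled back by [s], the form d^c F has explicit coefficients on R^2, and the claim splits into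
    one [angular_identity] for each j. *)
Lemma Kaehler_potentialP : Kaehler_potential u lambda nu omega J F.
Proof.
split; first exact: smooth_Kaehler_potential.
move=> s ss s0 e1 e2 X1 X2 t.
have ds e x : is_derive x e s ('D_e s x).
  by have [+ _] := ss 1%N e => /(_ x I) ?; split.
have dds e f x : is_derive x f ('D_e s) ('D_f ('D_e s) x).
  by have [_ /(_ f)[+ _]] := ss 2%N e => /(_ x I) ?; split.
have ts e x : tangent level (s x) ('D_e s x).
  exists (fun h : R => s (h *: e + x)).
  have /is_derive_lineP [d1 d2] := ds e x.
  split; [split; last exact: d1 | by rewrite scale0r add0r | by rewrite derive1E].
  by apply: (@filterE _ (nbhs (0 : R))) => h; exact: level0_level.
have alphaE e : (dc u lambda J (F \o nu)) \o (fun x => dq (s x) ('D_e s x)) =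
    (fun x => \sum_j (2^-1 + lambda 0 j / (s x 0 j ^+ 2 + s x 1 j ^+ 2)) *
       (s x 0 j * 'D_e s x 1 j - s x 1 j * 'D_e s x 0 j)).
  apply/funext => x; rewrite /= dc_Kaehler_potential//.
  by apply: eq_bigr => j _; rewrite [rot _ _ 0 j]mxE.
have sj k j e x := (is_derive_mxP _ _ _ _).1 (ds e x) k j.
have dsj k j e f x := (is_derive_mxP _ _ _ _).1 (dds e f x) k j.
have dalpha e f := is_derive_sum_fun (fun j => is_derive_angular (lambda 0 j)
  (sqnorm_gt0 hDelta hnu j (s0 t)) (sj 0 j f t) (sj 1 j f t) (dsj 0 j e f t) (dsj 1 j e f t)).
have dX e f := eq_ind_r (fun h => is_derive t f h _) (dalpha e f) (alphaE e).
have [d1 E1] := dX e2 e1; have [d2 E2] := dX e1 e2.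
split; [exact: d1 | exact: d2 |].
refine (etrans _ (esym (congr2 (fun y1 y2 : R => y1 - y2) E1 E2))).
rewrite homega//.
rewrite -sumrB; apply: eq_bigr => j _.
have E := smooth_derive_commute e1 e2 t ss.
have s1 := sqnorm_gt0 hDelta hnu j (s0 t).
have E0 := congr1 (fun m : 'M[R]_(2, d) => m 0 j) E.
have E1' := congr1 (fun m : 'M[R]_(2, d) => m 1 j) E.
exact: (angular_identity _ _ _ _ _ (lt0r_neq0 s1) E0 E1').
Qed.

End KaehlerPotential.
End Potentials.

Theorem theorem1 (R : realType) (n d : nat)
  (u : 'M[int]_(n, d)) (lambda : 'rV[R]_d)
  (hDelta : rational_Delzant u lambda)
  (nu : orbit_class R d -> 'rV[R]_n)
  (hnu : momentum_map u lambda nu)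
  (omega g : tangent_class R d -> tangent_class R d -> R)
  (J : tangent_class R d -> tangent_class R d)
  (homega : reduced_symplectic_form u lambda nu omega)
  (hg : Guillemin_metric u lambda nu g)
  (hJ : complex_structure u lambda nu omega g J) :
  [/\ forall h : 'rV[R]_n -> 'rV[R]_n -> 'rV[R]_n -> R,
        reduced_metric u lambda nu g h <->
        (forall x, Delta0 u lambda x -> forall a b,
           h x a b = 2^-1 * \sum_(j < d)
             ('D_a (fun y => ell u lambda y 0 j) x *
              'D_b (fun y => ell u lambda y 0 j) x) / ell u lambda x 0 j),
      dual_potential u lambda nu g
        (fun x => 2^-1 * \sum_(j < d)
           ell u lambda x 0 j * ln (ell u lambda x 0 j)) &
      Kaehler_potential u lambda nu omega J
        (fun x => 2^-1 * \sum_(j < d)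
           (lambda 0 j * ln (ell u lambda x 0 j) + ell u lambda x 0 j))].
Proof.
have redP h := reduced_metricP hDelta hnu h hg.
split.
- move=> h; rewrite redP; split=> H x Dx a b; first by rewrite H// metric_formE.
  by rewrite H// -metric_formE.
- split; first exact: smooth_dual_potential.
  by apply/redP => x Dx a b; exact: hessian_dual_potential.
- exact: (Kaehler_potentialP hDelta hnu homega hg hJ).
Qed.
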